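(* For every integer $n\geq 1$, the Gromov–Hausdorff distance between the unit spheres $\mathbb{S}^1$ and $\mathbb{S}^{2n+1}$, each endowed with its geodesic metric, is $$d_{\mathrm{GH}}(\mathbb{S}^1,\mathbb{S}^{2n+1})=\frac{\pi n}{2n+1}.$$
   Context: For $k\in\mathbb{N}=\{1,2,\dots\}$, $\mathbb{S}^k=\{x\in\mathbb{R}^{k+1}:\sum_{i=1}^{k+1}x_i^2=1\}$ is endowed with the geodesic metric $d_{\mathbb{S}^k}(x,y)=\arccos(\langle x,y\rangle)\in[0,\pi]$, where $\langle\cdot,\cdot\rangle$ is the Euclidean inner product. For nonempty subsets $A,B$ of a metric space $(Z,d_Z)$, the Hausdorff distance is $d_{\mathrm{H}}^Z(A,B)=\max\left(\sup_{a\in A}d_Z(a,B),\sup_{b\in B}d_Z(b,A)\right)$, where $d_Z(a,B)=\inf_{b\in B}d_Z(a,b)$. The Gromov–Hausdorff distance $d_{\mathrm{GH}}(X,Y)$ between nonempty metric spaces $X,Y$ is the infimum of $d_{\mathrm{H}}^Z(X',Y')$ over all metric spaces $Z$ and all subspaces $X',Y'\subseteq Z$ with $X'$ isometric to $X$ and $Y'$ isometric to $Y$. *)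

(* Defs.v *)
From HB Require Import structures.
From mathcomp Require Import all_boot all_order all_algebra.
From mathcomp Require Import all_classical all_reals all_analysis.
From mathcomp Require Import ring lra.

Set Implicit Arguments.
Unset Strict Implicit.
Unset Printing Implicit Defensive.

Import Order.TTheory GRing.Theory Num.Theory.
Import numFieldNormedType.Exports.

Local Open Scope classical_set_scope.
Local Open Scope ring_scope.

Definition dotv (R : realType) (m : nat) (x y : 'rV[R]_m) : R :=
  \sum_(i < m) x 0 i * y 0 i.

Section dotv_theory.
Context {R : realType} {m : nat}.
Implicit Types (x y z : 'rV[R]_m) (a : R).

Lemma dotvC x y : dotv x y = dotv y x.
Proof. by apply: eq_bigr => i _; rewrite mulrC. Qed.

Lemma dotvDl x y z : dotv (x + y) z = dotv x z + dotv y z.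
Proof.
by rewrite -big_split; apply: eq_bigr => i _; rewrite mxE mulrDl.
Qed.

Lemma dotvZl a x y : dotv (a *: x) y = a * dotv x y.
Proof. by rewrite big_distrr; apply: eq_bigr => i _; rewrite mxE -mulrA. Qed.

Lemma dotvDr x y z : dotv z (x + y) = dotv z x + dotv z y.
Proof. by rewrite dotvC dotvDl !(dotvC z). Qed.

Lemma dotvZr a x y : dotv x (a *: y) = a * dotv x y.
Proof. by rewrite dotvC dotvZl dotvC. Qed.

Lemma dotv_ge0 x : 0 <= dotv x x.
Proof. by apply: sumr_ge0 => i _; rewrite -expr2 sqr_ge0. Qed.

Lemma dotv_eq0 x : dotv x x = 0 -> x = 0.
Proof.
move=> /eqP; rewrite psumr_eq0 => [/allP x0|i _]; last by rewrite -expr2 sqr_ge0.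
apply/rowP => i; rewrite mxE.
by have /= := x0 i (mem_index_enum i); rewrite -expr2 sqrf_eq0 => /eqP.
Qed.

Lemma dotv_CauchySchwarz x y : dotv x y ^+ 2 <= dotv x x * dotv y y.
Proof.
have [y0|y0] := eqVneq (dotv y y) 0.
  have -> : dotv x y = 0.
    by rewrite (dotv_eq0 y0) /dotv big1// => i _; rewrite mxE mulr0.
  by rewrite y0 mulr0 expr0n.
have ygt0 : 0 < dotv y y by rewrite lt_neqAle eq_sym y0 dotv_ge0.
have := dotv_ge0 (dotv y y *: x + (- dotv x y) *: y).
rewrite !(dotvDl, dotvDr, dotvZl, dotvZr) (dotvC y x).
set U := dotv x x; set V := dotv y y in ygt0 *; set P := dotv x y.
rewrite [leRHS](_ : _ = V * (U * V - P ^+ 2)); last by rewrite /V /P; ring.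
by rewrite pmulr_rge0// subr_ge0.
Qed.

End dotv_theory.

Record sphere (R : realType) (k : nat) := Sphere {
  sphere_val :> 'rV[R]_k.+1 ;
  sphere_valP : \sum_(i < k.+1) sphere_val 0 i ^+ 2 == 1
}.

HB.instance Definition _ (R : realType) (k : nat) :=
  [isSub for @sphere_val R k].
HB.instance Definition _ (R : realType) (k : nat) :=
  [Choice of sphere R k by <:].

Definition geodesic_dist (R : realType) (k : nat) (x y : sphere R k) : R :=
  acos (dotv x y).

Section geodesic_theory.
Context {R : realType} {k : nat}.
Implicit Types x y z : sphere R k.

Lemma dotv_sphere x : dotv x x = 1.
Proof.
by rewrite -[RHS](eqP (sphere_valP x)); apply: eq_bigr => i _; rewrite expr2.
Qed.

Lemma dotv_sphere_bound x y : -1 <= dotv x y <= 1.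
Proof.
have := dotv_CauchySchwarz x y; rewrite !dotv_sphere mulr1 => xy1.
by rewrite -ler_norml -(@expr_le1 _ 2)// real_normK ?num_real.
Qed.

Lemma geodesic_dist_bound x y : 0 <= geodesic_dist x y <= pi.
Proof. by rewrite acos_ge0 ?acos_lepi ?dotv_sphere_bound. Qed.

Lemma cos_geodesic_dist x y : cos (geodesic_dist x y) = dotv x y.
Proof. by rewrite acosK// in_itv/= dotv_sphere_bound. Qed.

Lemma geodesic_distxx x : geodesic_dist x x = 0.
Proof. by rewrite /geodesic_dist dotv_sphere acos1. Qed.

Lemma geodesic_dist_positivity x y : geodesic_dist x y = 0 -> x = y.
Proof.
move=> xy0; have := cos_geodesic_dist x y; rewrite xy0 cos0 => xy1.
apply/val_inj/eqP; rewrite -subr_eq0; apply/eqP/dotv_eq0.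
rewrite -scaleN1r !(dotvDl, dotvDr, dotvZl, dotvZr) (dotvC y x).
by rewrite /= -xy1 !dotv_sphere; ring.
Qed.

Lemma geodesic_dist_sym x y : geodesic_dist x y = geodesic_dist y x.
Proof. by rewrite /geodesic_dist dotvC. Qed.

Lemma geodesic_dist_triangle y x z :
  geodesic_dist x z <= geodesic_dist x y + geodesic_dist y z.
Proof.
have /andP[a0 api] := geodesic_dist_bound x y.
have /andP[b0 bpi] := geodesic_dist_bound y z.
have /andP[c0 cpi] := geodesic_dist_bound x z.
have [piab|abpi] := leP pi (geodesic_dist x y + geodesic_dist y z).
  exact: le_trans piab.
rewrite leNgt -ltr_cos ?in_itv/= ?c0 ?cpi ?addr_ge0 ?(ltW abpi)// -leNgt.
rewrite cosD !cos_geodesic_dist.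
set sa := sin (geodesic_dist x y); set sb := sin (geodesic_dist y z).
have sa0 : 0 <= sa by rewrite sin_ge0_pi ?a0.
have sb0 : 0 <= sb by rewrite sin_ge0_pi ?b0.
have sa2 : sa ^+ 2 = 1 - dotv x y ^+ 2 by rewrite sin2cos2 cos_geodesic_dist.
have sb2 : sb ^+ 2 = 1 - dotv y z ^+ 2 by rewrite sin2cos2 cos_geodesic_dist.
set p := dotv x y in sa2 *; set q := dotv y z in sb2 *.
(* Cauchy-Schwarz for the components of x and z orthogonal to y *)
pose u := (x : 'rV_k.+1) + (- p) *: (y : 'rV_k.+1).
pose v := (z : 'rV_k.+1) + (- q) *: (y : 'rV_k.+1).
have uv : dotv u v = dotv x z - p * q.
  rewrite !(dotvDl, dotvDr, dotvZl, dotvZr) dotv_sphere -/p -/q.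
  by rewrite /p /q; ring.
have uu : dotv u u = sa ^+ 2.
  rewrite !(dotvDl, dotvDr, dotvZl, dotvZr) !dotv_sphere (dotvC y x) -/p sa2.
  by ring.
have vv : dotv v v = sb ^+ 2.
  rewrite !(dotvDl, dotvDr, dotvZl, dotvZr) !dotv_sphere (dotvC z y) -/q sb2.
  by ring.
have := dotv_CauchySchwarz u v.
rewrite uv uu vv -exprMn -ler_sqrt ?sqr_ge0// !sqrtr_sqr.
rewrite [X in _ <= X]ger0_norm ?mulr_ge0// ler_norml => /andP[+ _].
by rewrite lerBrDl.
Qed.

End geodesic_theory.

HB.instance Definition _ (R : realType) (k : nat) :=
  @isMetric.Build R (sphere R k) (@geodesic_dist R k)
    geodesic_distxx geodesic_dist_positivity geodesic_dist_sym
    geodesic_dist_triangle.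

Lemma mdist_sphereE (R : realType) (k : nat) (x y : sphere R k) :
  mdist x y = acos (\sum_(i < k.+1) (x : 'rV[R]_k.+1) 0 i * (y : 'rV[R]_k.+1) 0 i).
Proof. by []. Qed.

(* Distances between sets are extended reals: the Hausdorff distance between
   nonempty sets is +oo when one of the suprema is infinite. *)
Definition dist_to_set (R : realType) (Z : metricType R) (z : Z) (B : set Z) :
    \bar R :=
  ereal_inf [set (mdist z b)%:E | b in B].

Definition hausdorff_dist (R : realType) (Z : metricType R) (A B : set Z) :
    \bar R :=
  maxe (ereal_sup [set dist_to_set a B | a in A])
       (ereal_sup [set dist_to_set b A | b in B]).

(* [X'], with the distance induced by [Z], is isometric to [X].  Injectivity of
   [f] follows from the preservation of distances. *)
Definition isometric_copy (R : realType) (X Z : metricType R) (X' : set Z) :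
    Prop :=
  exists f : X -> Z,
    (forall x y, mdist (f x) (f y) = mdist x y) /\ f @` [set: X] = X'.

(* Intended for nonempty [X] and [Y]. *)
Definition gromov_hausdorff_dist (R : realType) (X Y : metricType R) : \bar R :=
  ereal_inf [set r | exists (Z : metricType R) (X' Y' : set Z),
    [/\ isometric_copy X X', isometric_copy Y Y' & r = hausdorff_dist X' Y']].

(* Main.v *)
(* Put m = 2n + 1.

   Upper bound. Identify x in S^(2n+1) with the trigonometric polynomial P_x
   with frequencies 1, 3, ..., m, and relate a point of the circle of angle t to
   x when P_x is maximal at t. By oddness, the distortion of this correspondence
   is at most pi - pi/m as soon as d(x, y) >= pi/m - s whenever P_x has its
   maximum A at t, P_y has its minimum -B at t + s or t - s, and s <= pi/m.
   By a lemma of M. Riesz, a polynomial p of this kind with maximum p(0)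
   satisfies p(u) >= p(0) cos(mu) for |u| <= pi/m: indeed
   p(u) = p(0) cos(mu) + sin(u) h(u), where h has even frequencies and h(0) = 0,
   and interpolating h at the points k pi/m expresses sin(u) h(u) as a sum of
   nonnegative terms. Halfway between the two extrema, P_x - P_y is therefore at
   least (A + B) cos(ms/2), where A and B are at least 1/sqrt 2 by Parseval's
   identity; Cauchy-Schwarz then bounds |x - y| from below.

   Lower bound. A map g from S^(2n+1) to the circle of distortion less than
   pi - pi/m can be made odd without increasing its distortion. Label a point x
   by a sign and an angle in [0, pi[ locating the image of x up to sign. Ky Fan's
   lemma, applied to a fine triangulation of S^(2n), yields m points close to
   each other whose signs alternate when they are sorted by angle. Neighbouring
   angles then differ by more than pi/m, so that the images of the first and the
   last points are too far apart. Ky Fan's lemma itself follows from two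
   relations modulo 2: the coboundary of the alternating k-cochain is the
   symmetrized alternating (k+1)-cochain, and the boundary of a k-dimensional
   hemisphere is the symmetrized (k-1)-dimensional one. *)
Require Import Defs.
From HB Require Import structures.
From mathcomp Require Import all_boot all_order all_algebra.
From mathcomp Require Import all_classical all_reals all_analysis.
From mathcomp Require Import ring lra zify.

Set Implicit Arguments.
Unset Strict Implicit.
Unset Printing Implicit Defensive.

Import Order.TTheory GRing.Theory Num.Theory.
Import numFieldNormedType.Exports.

Local Open Scope classical_set_scope.
Local Open Scope ring_scope.

(** * Chains modulo 2 and Ky Fan's lemma *)

(* A chain modulo 2 is a list of ordered, possibly degenerate, vertex tuples; it
   is only used through its pairings [ev A c] with cochains. *)
Definition ev (V : Type) (A : seq V -> bool) (c : seq (seq V)) : bool :=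
  \big[addb/false]_(s <- c) A s.

Lemma ev_map (V W : Type) (A : seq V -> bool) (g : seq W -> seq V) c :
  ev A (map g c) = ev (A \o g) c.
Proof. exact: big_map. Qed.

(** The complex is augmented: the boundary of a vertex is the empty tuple, on which Ky Fan's
    induction starts. *)
Fixpoint bd (V : Type) (s : seq V) : seq (seq V) :=
  if s is v :: s' then s' :: [seq v :: r | r <- bd s'] else [::].

Lemma map_bd (L L' : Type) (f : L -> L') (s : seq L) :
  bd (map f s) = map (map f) (bd s).
Proof. by elim: s => [//|v s IH] /=; rewrite IH -!map_comp. Qed.

Section Chains.
Variable V : eqType.
Implicit Types (s : seq V) (c : seq (seq V)) (A : seq V -> bool).

Definition bdC c := flatten [seq bd s | s <- c].

Lemma ev_cat A c1 c2 : ev A (c1 ++ c2) = ev A c1 (+) ev A c2.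
Proof. exact: big_cat. Qed.

Lemma ev_flatten A (F : seq V -> seq (seq V)) c :
  ev A (flatten [seq F s | s <- c]) = ev (fun s => ev A (F s)) c.
Proof. by rewrite /ev big_flatten big_map. Qed.

Lemma eq_in_ev A B c : {in c, A =1 B} -> ev A c = ev B c.
Proof. by move=> AB; apply: eq_big_seq. Qed.

Lemma ev_addb A B c : ev (fun s => A s (+) B s) c = ev A c (+) ev B c.
Proof. exact: big_split. Qed.

Lemma ev_bdC A c : ev A (bdC c) = ev (fun s => ev A (bd s)) c.
Proof. exact: ev_flatten. Qed.

(** The cone formula $\partial(v c) = c + v\,\partial c$ modulo 2, behind both subdivisions and
    hemispheres. *)
Lemma ev_bd_cone A v c :
  ev A (bdC [seq v :: s | s <- c]) = ev A c (+) ev (A \o cons v) (bdC c).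
Proof.
rewrite !ev_bdC ev_map -ev_addb; apply: eq_in_ev => s _ /=.
by rewrite {1}/ev big_cons -/(ev _ _) ev_map.
Qed.

Lemma ev_bd_bd A s : ev A (bdC (bd s)) = false.
Proof.
elim: s A => [|v s IH] A; first by rewrite /ev big_nil.
rewrite [bdC _]/(bd s ++ bdC _) ev_cat ev_bd_cone IH addbF addbb //.
Qed.

Lemma size_bd s r : r \in bd s -> (size r).+1 = size s.
Proof.
elim: s r => [//|v s IH] r; rewrite inE => /orP[/eqP->//|/mapP[q /IH qs ->] /=].
by rewrite qs.
Qed.

Lemma mem_bd s r : r \in bd s -> {subset r <= s}.
Proof.
elim: s r => [//|v s IH] r; rewrite inE => /orP[/eqP->|/mapP[q /IH qs ->]] x.
  by rewrite inE => ->; rewrite orbT.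
by rewrite !inE => /orP[->//|/qs ->]; rewrite orbT.
Qed.

Section Subdivision.
Variable bary : seq V -> V.

(* Barycentric subdivision; the fuel [k] has to be [size s]. *)
Fixpoint sd k s : seq (seq V) :=
  if k is k'.+1 then [seq bary s :: r | r <- flatten [seq sd k' q | q <- bd s]]
  else [:: s].

Definition sdC k c := flatten [seq sd k s | s <- c].

Lemma ev_sdC A k c : ev A (sdC k c) = ev (fun s => ev A (sd k s)) c.
Proof. exact: ev_flatten. Qed.

Lemma sdC_cat k c1 c2 : sdC k (c1 ++ c2) = sdC k c1 ++ sdC k c2.
Proof. by rewrite /sdC map_cat flatten_cat. Qed.

Lemma size_sd k s r : size s = k -> r \in sd k s -> size r = k.
Proof.
elim: k s r => [|k IH] s r /= sk; first by rewrite inE => /eqP ->.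
case/mapP => q /flattenP[c /mapP[p ps ->]] qp -> /=; congr _.+1.
by apply: IH qp; apply/succn_inj; rewrite (size_bd ps).
Qed.

(** [sd] cones from the barycentre over the subdivided boundary; by induction the boundary of this
    base is the subdivision of [bdC (bd s)], hence 0. *)
Lemma ev_bd_sd A k s : size s = k.+1 ->
  ev A (bdC (sd k.+1 s)) = ev A (sdC k (bd s)).
Proof.
elim: k s A => [|k IH] s A sk.
  move: sk; case: s => [//|v [|//]] _.
  by rewrite /sdC /= /ev /= !big_cons big_nil.
rewrite [LHS]ev_bd_cone -[X in _ (+) X = _]/(ev _ (bdC (sdC k.+1 (bd s)))).
rewrite [X in _ (+) X](_ : _ = false) ?addbF//.
rewrite ev_bdC ev_sdC.
rewrite (@eq_in_ev _ (fun r => ev (fun q => ev (A \o cons (bary s)) (sd k q)) (bd r))).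
  by rewrite -ev_bdC ev_bd_bd.
move=> r rs /=; rewrite -ev_bdC IH ?ev_sdC//.
by apply/succn_inj; rewrite (size_bd rs).
Qed.

Definition allsize k c := forall s, s \in c -> size s = k.

Lemma allsize_sdC k c : allsize k c -> allsize k (sdC k c).
Proof.
move=> ck s /flattenP[d /mapP[r rc ->]]; apply: size_sd; exact: ck.
Qed.

Lemma allsize_iter_sdC N k c : allsize k c -> allsize k (iter N (sdC k) c).
Proof. by move=> ck; elim: N => [//|N IH] /=; apply: allsize_sdC. Qed.

Lemma ev_bd_sdC A k c : allsize k.+1 c ->
  ev A (bdC (sdC k.+1 c)) = ev A (sdC k (bdC c)).
Proof.
move=> ck; rewrite ev_bdC ev_sdC [RHS]ev_sdC ev_bdC.
apply: eq_in_ev => s sc; rewrite -ev_bdC ev_bd_sd ?ev_sdC//; exact: ck.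
Qed.

Lemma ev_bd_iter_sdC A N k c : allsize k.+1 c ->
  ev A (bdC (iter N (sdC k.+1) c)) = ev A (iter N (sdC k) (bdC c)).
Proof.
move=> ck; elim: N A => [//|N IH] A /=.
rewrite ev_bd_sdC ?ev_sdC; last exact: allsize_iter_sdC.
exact: IH.
Qed.

Lemma eq_ev_iter_sdC N k c1 c2 : (forall A, ev A c1 = ev A c2) ->
  forall A, ev A (iter N (sdC k) c1) = ev A (iter N (sdC k) c2).
Proof. by move=> c12; elim: N => [//|N IH] A /=; rewrite !ev_sdC. Qed.

Lemma iter_sdC_cat N k c1 c2 :
  iter N (sdC k) (c1 ++ c2) = iter N (sdC k) c1 ++ iter N (sdC k) c2.
Proof. by elim: N => [//|N IH]; rewrite !iterS IH sdC_cat. Qed.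

Lemma iter_sdC0 N : iter N (sdC 0) [:: [::]] = [:: [::]].
Proof. by elim: N => [//|N IH]; rewrite iterS IH. Qed.

Variable T : V -> V.
Hypothesis TK : involutive T.
Hypothesis baryT : forall s, bary (map T s) = T (bary s).

Definition chT c := [seq map T s | s <- c].

Lemma bdC_chT c : bdC (chT c) = chT (bdC c).
Proof.
rewrite /bdC /chT map_flatten -!map_comp; congr flatten.
by apply: eq_map => s /=; rewrite map_bd.
Qed.

Lemma sd_map k s : sd k (map T s) = chT (sd k s).
Proof.
elim: k s => [//|k IH] s /=.
rewrite baryT map_bd.
have -> : flatten [seq sd k q | q <- chT (bd s)] =
    chT (flatten [seq sd k q | q <- bd s]).
  rewrite /chT map_flatten -!map_comp; congr flatten; apply: eq_map => r /=.
  exact: IH.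
by rewrite /chT -!map_comp.
Qed.

Lemma sdC_chT k c : sdC k (chT c) = chT (sdC k c).
Proof.
rewrite /sdC /chT map_flatten -!map_comp; congr flatten.
by apply: eq_map => s /=; rewrite sd_map.
Qed.

Lemma iter_sdC_chT N k c : iter N (sdC k) (chT c) = chT (iter N (sdC k) c).
Proof. by elim: N => [//|N IH]; rewrite !iterS IH sdC_chT. Qed.

Variable e : nat -> V.

(* A hemisphere of dimension [k]: the cone with apex [e k] over the sphere
   of dimension [k - 1]. *)
Fixpoint hemi k : seq (seq V) :=
  if k is k'.+1 then [seq e k :: s | s <- hemi k' ++ chT (hemi k')]
  else [:: [:: e 0]].

Lemma allsize_hemi k : allsize k.+1 (hemi k).
Proof.
elim: k => [|k IH] s /=; first by rewrite inE => /eqP ->.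
case/mapP => r; rewrite mem_cat => /orP[/IH rk -> /=|/mapP[q /IH qk ->] -> /=].
  by rewrite rk.
by rewrite size_map qk.
Qed.

(** The base of the cone is a chain plus its image under [T]. Their boundaries coincide modulo 2, so
    the base is a cycle. *)
Lemma ev_bd_hemi A k :
  ev A (bdC (hemi k.+1)) = ev A (hemi k ++ chT (hemi k)).
Proof.
elim: k A => [|k IH] A; rewrite ev_bd_cone [X in _ (+) X](_ : _ = false) ?addbF//.
  by rewrite /bdC /= /ev !big_cons big_nil addbF addbb.
rewrite ev_bdC ev_cat -!ev_bdC bdC_chT ev_map !IH !ev_cat !ev_map.
set B := A \o cons _; have -> : ev ((B \o map T) \o map T) (hemi k) = ev B (hemi k).
  by apply: eq_in_ev => s _ /=; rewrite mapK.
by rewrite [X in _ (+) X]addbC addbb.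
Qed.

End Subdivision.
End Chains.

(** * Alternating cochains *)

Section Alternating.

Fixpoint altb (b : bool) (w : seq bool) : bool :=
  if w is x :: w' then (x == b) && altb (~~ b) w' else true.

(** If the word alternates from [b], only deleting its last letter leaves a word alternating from
    [b]; if from [~~ b], only deleting the first. Otherwise the possible deletions are the two
    letters of a repeated pair, and cancel. *)
Lemma ev_altb b w : ev (altb b) (bd w) = altb b w (+) altb (~~ b) w.
Proof.
elim: w b => [|x w IH] b; first by rewrite /ev big_nil.
rewrite {1}/ev big_cons -/(ev _ _) ev_map.
have -> : ev (altb b \o cons x) (bd w) = (x == b) && ev (altb (~~ b)) (bd w).
  case E: (x == b); first by apply: eq_in_ev => r _ /=; rewrite E.
  by rewrite /ev big1// => r _ /=; rewrite E.
by rewrite IH /=; case: x; case: b; case: (altb true w); case: (altb false w).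
Qed.

Lemma altb_negb b w : altb b (map negb w) = altb (~~ b) w.
Proof. by elim: w b => [//|x w IH] b /=; rewrite IH; case: x; case: b. Qed.

(** [rem] deletes the first occurrence of [x]; with repeated entries this is the intended face only
    up to permutation. *)
Lemma ev_bd_rem (L : eqType) (F : seq L -> bool) (s : seq L) :
    (forall s1 s2, perm_eq s1 s2 -> F s1 = F s2) ->
  ev F (bd s) = \big[addb/false]_(x <- s) F (rem x s).
Proof.
elim: s F => [|v s IH] F FP; first by rewrite /ev !big_nil.
rewrite {1}/ev !big_cons /= eqxx -/(ev _ _) ev_map IH; last first.
  by move=> s1 s2 s12 /=; apply: FP; rewrite perm_cons.
congr (_ (+) _); apply: eq_big_seq => x xs /=; case: eqP => [->|_ //].
by apply: FP; rewrite perm_sym; apply: perm_to_rem.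
Qed.

Lemma ev_bd_perm (L : eqType) (F : seq L -> bool) (s t : seq L) :
    (forall s1 s2, perm_eq s1 s2 -> F s1 = F s2) ->
  perm_eq s t -> ev F (bd s) = ev F (bd t).
Proof.
move=> FP st; rewrite !ev_bd_rem// (perm_big _ st); apply: eq_big_seq => x xt.
have xs : x \in s by rewrite (perm_mem st).
apply: FP; rewrite -(perm_cons x) -(permPl (perm_to_rem xs)).
by rewrite (perm_trans st)// perm_to_rem.
Qed.

Lemma bd_subseq (L : eqType) (s r : seq L) : r \in bd s -> subseq r s.
Proof.
elim: s r => [//|v s IH] r; rewrite inE => /orP[/eqP->|/mapP[q /IH qs ->]].
  exact: subseq_cons.
by rewrite /= eqxx.
Qed.

Variables (d : Order.disp_t) (P : orderType d) (V : eqType).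
Variables (pos : V -> P) (sgn : V -> bool).

Definition lab v := (pos v, sgn v).

(* Breaking ties by sign makes [sort] independent of the order of the vertices. *)
Definition lel (p q : P * bool) :=
  (p.1 < q.1)%O || (p.1 == q.1) && (p.2 ==> q.2).

Lemma lel_total : total lel.
Proof.
move=> [p1 p2] [q1 q2]; rewrite /lel /=.
by case: (ltgtP p1 q1) => //=; case: p2; case: q2.
Qed.

Lemma lel_trans : transitive lel.
Proof.
move=> [p1 p2] [q1 q2] [r1 r2]; rewrite /lel /=.
case/orP => [pq|/andP[/eqP<- pq]] /orP[qr|/andP[/eqP<- qr]].
- by rewrite (lt_trans pq qr).
- by rewrite pq.
- by rewrite qr.
- rewrite eqxx /=; apply/orP; right.
  by move: pq qr; case: p2; case: q2; case: r2.
Qed.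

Lemma lel_anti : antisymmetric lel.
Proof.
move=> [p1 p2] [q1 q2]; rewrite /lel /=.
by case: (ltgtP p1 q1) => //= -> /andP[]; case: p2; case: q2.
Qed.

Definition slab (s : seq V) := sort lel (map lab s).
Definition alt b (s : seq V) := altb b (map snd (slab s)).

(** The coboundary may be computed on the sorted labels, whose faces are again sorted; there it is
    [ev_altb]. *)
Lemma ev_alt b s : ev (alt b) (bd s) = alt b s (+) alt (~~ b) s.
Proof.
rewrite -ev_altb.
pose F t := altb b (map snd (sort lel t)).
have FP s1 s2 : perm_eq s1 s2 -> F s1 = F s2.
  move=> s12; rewrite /F; congr (altb b (map snd _)).
  by apply/(perm_sortP lel_total lel_trans lel_anti).
have -> : ev (alt b) (bd s) = ev F (bd (map lab s)) by rewrite map_bd ev_map.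
rewrite (ev_bd_perm (t := slab s) FP); last by rewrite perm_sym perm_sort.
rewrite map_bd ev_map; apply: eq_in_ev => r /bd_subseq rs /=.
rewrite /F sorted_sort //; first exact: lel_trans.
apply: (subseq_sorted lel_trans rs); exact: sort_sorted lel_total _.
Qed.

(** Ky Fan's condition that no edge carries opposite labels. *)
Definition consistent (s : seq V) :=
  {in s &, forall x y, pos x = pos y -> sgn x = sgn y}.

Variable T : V -> V.

(** Negating signs reverses the tie-breaking of [lel]; consistency excludes ties between opposite
    signs, so the sorted order survives. *)
Lemma alt_map b s : consistent s ->
    {in s, forall x, pos (T x) = pos x} ->
    {in s, forall x, sgn (T x) = ~~ sgn x} ->
  alt b (map T s) = alt (~~ b) s.
Proof.
move=> cs posT sgnT; rewrite /alt -altb_negb.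
congr altb.
pose fl (p : P * bool) := (p.1, ~~ p.2).
have -> : slab (map T s) = map fl (slab s).
  apply: (sorted_eq lel_trans lel_anti); first exact: sort_sorted lel_total _.
    rewrite sorted_map.
    pose Q := [pred p | p \in map lab s].
    have ss : all Q (slab s) by apply/allP => p; rewrite mem_sort.
    apply: (@sub_in_sorted _ Q lel _ _ _ ss); last exact: sort_sorted lel_total _.
    move=> p q /mapP[x xs ->] /mapP[y ys ->]; rewrite /lel /=.
    case/orP => [->//|/andP[/eqP xy _]].
    by rewrite (cs _ _ xs ys xy) xy eqxx implybb orbT.
  rewrite perm_sort perm_sym (perm_trans (perm_map _ (permEl (perm_sort _ _))))//.
  rewrite -!map_comp; apply/permPl; rewrite (_ : map _ _ = map (lab \o T) s)//.
  by apply/eq_in_map => x xs; rewrite /= /fl /lab /= posT// sgnT.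
by rewrite -!map_comp.
Qed.

Variable bary : seq V -> V.
Hypothesis TK : involutive T.
Hypothesis baryT : forall s, bary (map T s) = T (bary s).
Variable e : nat -> V.

(* Ky Fan's combinatorial lemma, for the N-th barycentric subdivision of the
   cross-polytope. *)
Lemma ky_fan N k :
    (forall j s, (j <= k)%N -> s \in iter N (sdC bary j.+1) (hemi T e j) ->
      [/\ consistent s, {in s, forall x, pos (T x) = pos x} &
          {in s, forall x, sgn (T x) = ~~ sgn x}]) ->
  exists2 s, s \in iter N (sdC bary k.+1) (hemi T e k) &
    exists b, alt b s.
Proof.
move=> H.
(* Existence follows from parity: the number of alternating simplices is odd. *)
suff : ev (fun s => alt true s (+) alt false s)
          (iter N (sdC bary k.+1) (hemi T e k)) = true.
  move=> E; have /hasP[s sk ss] : has (fun s => alt true s (+) alt false s)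
      (iter N (sdC bary k.+1) (hemi T e k)).
    apply: contraTT E => /hasPn E; rewrite /ev big1_seq// => s /andP[_ /E].
    by move/negbTE.
  exists s => //; move: ss; case E1: (alt true s); first by exists true.
  by rewrite /= => E2; exists false.
elim: k H => [|k IH] H.
  (* In dimension 0 the boundary is the empty tuple, which counts as alternating. *)
  rewrite (@eq_in_ev _ _ (fun s => ev (alt true) (bd s))); last first.
    by move=> s _ /=; rewrite ev_alt.
  rewrite -ev_bdC ev_bd_iter_sdC; last exact: allsize_hemi.
  by rewrite iter_sdC0 /ev big_cons big_nil.
(* A coboundary of [alt true] is evaluated on the boundary of the hemisphere. The two halves of that
   boundary are exchanged by [T], which turns [alt true] into [alt false]. *)
rewrite (@eq_in_ev _ _ (fun s => ev (alt true) (bd s))); last first.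
  by move=> s _ /=; rewrite ev_alt.
rewrite -ev_bdC ev_bd_iter_sdC; last exact: allsize_hemi.
rewrite (eq_ev_iter_sdC _ _ _ (fun A => ev_bd_hemi TK e A k)).
rewrite iter_sdC_cat (iter_sdC_chT baryT) ev_cat ev_map -ev_addb -[RHS]IH.
  apply: eq_in_ev => s sk /=.
  by have [c1 c2 c3] := H k s (leqnSn _) sk; rewrite alt_map.
by move=> j s jk; apply: H; apply: leqW.
Qed.

End Alternating.

(** * Trigonometric polynomials *)

Section TrigSums.
Context {R : realType}.
Implicit Types (t u phi : R) (l k : nat).

Lemma sin_mul_cos t u : 2 * (sin t * cos u) = sin (u + t) - sin (u - t).
Proof. by rewrite sinB sinD; ring. Qed.

Lemma sin_mul_sin t u : 2 * (sin t * sin u) = cos (u - t) - cos (u + t).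
Proof. by rewrite cosB cosD; ring. Qed.

Lemma cos_mul_cos t u : 2 * (cos t * cos u) = cos (u - t) + cos (u + t).
Proof. by rewrite cosB cosD; ring. Qed.

(** Telescoping, as $2\sin h\cos(2ih+\varphi) = \sin((2i+1)h+\varphi)-\sin((2i-1)h+\varphi)$. *)
Lemma sum_cos_arith (h : R) phi k :
  2 * sin h * \sum_(i < k) cos (i%:R * (2 * h) + phi) =
  sin (k%:R * (2 * h) - h + phi) - sin (phi - h).
Proof.
elim: k => [|k IH].
  by rewrite big_ord0 mulr0 mul0r sub0r [- h + _]addrC subrr.
rewrite big_ord_recr mulrDr IH /= -mulrA sin_mul_cos -[k.+1%:R]natr1.
rewrite [X in _ + (sin X - _)](_ : _ = (k%:R + 1) * (2 * h) - h + phi); last by ring.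
rewrite [X in _ + (_ - sin X)](_ : _ = k%:R * (2 * h) - h + phi); last by ring.
ring.
Qed.

Lemma sinDnpi t k : sin (t + k%:R * pi) = (-1) ^+ k * sin t.
Proof.
by rewrite mulr_natl (alternatingn (@sinDpi R)).
Qed.

Lemma cosDnpi t k : cos (t + k%:R * pi) = (-1) ^+ k * cos t.
Proof.
by rewrite mulr_natl (alternatingn (@cosDpi R)).
Qed.

Lemma sum_cos_roots (m a : nat) phi : (0 < a < m)%N ->
  \sum_(k < m) cos (2 * a%:R * (k%:R * pi / m%:R) + phi) = 0.
Proof.
case/andP => a0 am; have m0 : m%:R != 0 :> R.
  by rewrite pnatr_eq0 -lt0n (leq_ltn_trans _ am).
pose h := a%:R * pi / m%:R : R.
have h0 : sin h != 0.
  rewrite gt_eqF// sin_gt0_pi// /h divr_gt0 ?mulr_gt0 ?pi_gt0 ?ltr0n//=; last first.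
    by rewrite (leq_ltn_trans _ am).
  rewrite ltr_pdivrMr ?ltr0n ?(leq_ltn_trans _ am)// [ltRHS]mulrC.
  by rewrite ltr_pM2r ?pi_gt0// ltr_nat.
apply: (mulfI (x := 2 * sin h)); first by rewrite mulf_neq0.
rewrite mulr0 -[RHS](subrr (sin (phi - h))).
transitivity (2 * sin h * \sum_(i < m) cos (i%:R * (2 * h) + phi)).
  by congr (_ * _); apply: eq_bigr => i _; congr cos; rewrite /h; ring.
rewrite sum_cos_arith; congr (_ - _).
rewrite (_ : _ + phi = phi - h + (2 * a)%:R * pi).
  by rewrite sinDnpi exprM sqrrN expr1n expr1n mul1r.
by rewrite /h natrM; field.
Qed.

(** The Dirichlet kernel at $2u$, equal to $\sin(mu)/\sin u$ with $m = 2n+1$ where $\sin u \neq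
    0$. *)
Definition dirichlet (n : nat) u : R := 1 + 2 * \sum_(l < n) cos (2 * l.+1%:R * u).

Lemma sin_dirichlet n u : sin u * dirichlet n u = sin ((2 * n).+1%:R * u).
Proof.
rewrite /dirichlet; elim: n => [|n IH].
  by rewrite big_ord0 mulr0 addr0 mulr1 mul1r.
rewrite big_ord_recr /= [2 * (_ + _)]mulrDr addrA mulrDr IH mulrCA sin_mul_cos.
rewrite [X in _ + (sin X - _)](_ : _ = (2 * n.+1).+1%:R * u); last first.
  by rewrite -[(2 * n.+1).+1%:R]natr1 natrM; ring.
rewrite [X in _ + (_ - sin X)](_ : _ = (2 * n).+1%:R * u); first by ring.
by rewrite -[(2 * n).+1%:R]natr1 -[n.+1%:R]natr1 natrM; ring.
Qed.

Lemma continuous_cos_lin a phi : continuous (fun t => cos (a * t + phi)).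
Proof.
move=> t; apply: (@continuous_comp _ _ _ (fun t => a * t + phi) cos); last exact: continuous_cos.
by apply: cvgD; [apply: cvgM; [exact: cvg_cst|exact: cvg_id]|exact: cvg_cst].
Qed.

(** * Interpolation and the lemma of M. Riesz *)

Section Interpolation.
Variable n : nat.
Let m := (2 * n).+1.

(* Satisfied by all real trigonometric polynomials with even frequencies at
   most [2 * n]. *)
Definition interpolates (h : R -> R) := continuous h /\
  forall t, m%:R * h t =
    \sum_(k < m) h (k%:R * pi / m%:R) * dirichlet n (t - k%:R * pi / m%:R).

Lemma interpolates_cst0 : interpolates (fun=> 0).
Proof.
split; first by move=> t; exact: cvg_cst.
by move=> t; rewrite mulr0 big1// => k _; rewrite mul0r.
Qed.

Lemma interpolatesD g h : interpolates g -> interpolates h ->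
  interpolates (fun t => g t + h t).
Proof.
move=> [cg ig] [ch ih]; split; first by move=> t; exact: cvgD (cg t) (ch t).
move=> t; rewrite mulrDr ig ih -big_split; apply: eq_bigr => k _ /=.
by rewrite mulrDl.
Qed.

Lemma interpolatesZ a h : interpolates h -> interpolates (fun t => a * h t).
Proof.
move=> [ch ih]; split; first by move=> t; apply: cvgM (ch t); exact: cvg_cst.
by move=> t; rewrite mulrCA ih big_distrr; apply: eq_bigr => k _ /=; rewrite mulrA.
Qed.

Lemma interpolates_sum (K : nat) (F : 'I_K -> R -> R) :
  (forall i, interpolates (F i)) -> interpolates (fun t => \sum_(i < K) F i t).
Proof.
elim: K F => [|K IH] F HF.
  rewrite (_ : (fun _ => _) = fun=> 0); first exact: interpolates_cst0.
  by apply/funext => t; rewrite big_ord0.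
rewrite (_ : (fun _ => _) = fun t =>
  \sum_(i < K) F (widen_ord (leqnSn K) i) t + F ord_max t).
  by apply: interpolatesD => //; apply: IH.
by apply/funext => t; rewrite big_ord_recr.
Qed.

Let m0 : m%:R != 0 :> R. Proof. by rewrite pnatr_eq0. Qed.

Let sum_cos_diff (l l' : nat) phi : (l <= n)%N -> (l' <= n)%N ->
  \sum_(k < m) cos ((2 * l%:R - 2 * l'%:R) * (k%:R * pi / m%:R) + phi) =
  if l == l' then m%:R * cos phi else 0.
Proof.
move=> ln ln'; case: (ltngtP l l') => ll'.
- rewrite -[RHS](@sum_cos_roots m (l' - l) (- phi)).
    apply: eq_bigr => k _; rewrite -cosN natrB 1?ltnW//; congr cos; ring.
  rewrite subn_gt0 ll' (leq_ltn_trans (leq_subr _ _))// ltnS.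
  by rewrite (leq_trans ln')// leq_pmull.
- rewrite -[RHS](@sum_cos_roots m (l - l') phi).
    apply: eq_bigr => k _; rewrite natrB 1?ltnW//; congr cos; ring.
  rewrite subn_gt0 ll' (leq_ltn_trans (leq_subr _ _))// ltnS.
  by rewrite (leq_trans ln)// leq_pmull.
- under eq_bigr do rewrite ll' subrr mul0r add0r.
  by rewrite sumr_const card_ord mulr_natl.
Qed.

(** Multiplied by the kernel, the cosine splits into frequencies $2(l-l')$ and $2(l+l')$. Summed
    over the nodes, the former vanish unless $l = l'$, and the latter always, since $0 < l+l' < m$
    for $1 \leq l' \leq n$. *)
Lemma interpolates_cos (l : nat) psi : (l <= n)%N ->
  interpolates (fun t => cos (2 * l%:R * t + psi)).
Proof.
move=> ln; split; first exact: continuous_cos_lin.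
move=> t; pose t_ k : R := k%:R * pi / m%:R.
have E k : cos (2 * l%:R * t_ k + psi) * dirichlet n (t - t_ k) =
    cos ((2 * l%:R - 2 * 0%:R) * t_ k + psi) + \sum_(l' < n)
      (cos ((2 * l%:R - 2 * l'.+1%:R) * t_ k + (2 * l'.+1%:R * t + psi)) +
       cos (2 * (l + l'.+1)%:R * t_ k + (psi - 2 * l'.+1%:R * t))).
  rewrite mulr0 subr0 mulrDr mulr1; congr (_ + _).
  rewrite mulrCA !big_distrr /=; apply: eq_bigr => l' _.
  rewrite [in LHS](mulrC (cos _)) cos_mul_cos addrC natrD.
  by congr (cos _ + cos _); ring.
under eq_bigr do rewrite E.
rewrite big_split exchange_big /= sum_cos_diff//.
transitivity (\sum_(l' < n.+1)
    if l == l' then m%:R * cos (2 * l'%:R * t + psi) else 0).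
  rewrite (bigD1 (inord l)) //= inordK// eqxx big1 ?addr0// => i il.
  case: eqP => // li; move/eqP: il; case; apply/val_inj => /=.
  by rewrite inordK.
rewrite big_ord_recl /= mulr0 mul0r add0r; congr (_ + _).
apply: eq_bigr => l' _; rewrite big_split /= sum_cos_diff//.
rewrite sum_cos_roots ?addr0// addnS /= /m ltnS mul2n -addnn -addnS.
by rewrite leq_add.
Qed.

Lemma interpolates_dirichlet : interpolates (dirichlet n).
Proof.
apply: interpolatesD.
  have := @interpolates_cos 0 0 (leq0n _).
  rewrite (_ : (fun t => cos _) = fun=> 1)//.
  by apply/funext => t; rewrite mulr0 mul0r addr0 cos0.
apply/interpolatesZ/interpolates_sum => i.
have := @interpolates_cos i.+1 0 (ltn_ord i).
by rewrite (_ : (fun t => cos _) = fun t => cos (2 * i.+1%:R * t))//;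
  apply/funext => t; rewrite addr0.
Qed.

Definition odd_trig (p : R -> R) := exists2 h, interpolates h &
  forall t, p t = p 0 * cos (m%:R * t) + sin t * h t.

Lemma odd_trig_sum (K : nat) (x : 'I_K -> R) (F : 'I_K -> R -> R) :
  (forall i, odd_trig (F i)) -> odd_trig (fun t => \sum_(i < K) x i * F i t).
Proof.
move=> /(_ _)/cid2-/all_sig2[h ih Fh].
exists (fun t => \sum_(i < K) x i * h i t).
  by apply: interpolates_sum => i; apply: interpolatesZ.
move=> t; rewrite big_distrl big_distrr -big_split; apply: eq_bigr => i _ /=.
by rewrite {1}Fh; ring.
Qed.

(** Downward induction on the frequency: $\sin mt$ is $\sin t$ times the kernel, and two consecutive
    odd frequencies differ by $2\sin t\sin(2lt+\psi)$. *)
Lemma odd_trig_cos (l : nat) psi : (l <= n)%N ->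
  odd_trig (fun t => cos ((2 * l).+1%:R * t + psi)).
Proof.
move=> ln; rewrite -(subKn ln); move: (n - l)%N (leq_subr l n) => d.
elim: d => [|d IH] dn.
  rewrite subn0; exists (fun t => - sin psi * dirichlet n t).
    exact/interpolatesZ/interpolates_dirichlet.
  by move=> t; rewrite mulr0 add0r mulrCA sin_dirichlet cosD; ring.
have [h ih hE] := IH (ltnW dn).
exists (fun t => h t + 2 * cos (2 * (n - d)%:R * t + (psi - pi / 2))).
  apply: interpolatesD => //; apply/interpolatesZ/interpolates_cos.
  exact: leq_subr.
move=> t; rewrite mulr0 add0r.
have := hE t; rewrite mulr0 add0r mulrDr addrA => <-.
rewrite addrA cosBpihalf mulrCA sin_mul_sin -(subnSK dn).
set q := (n - d.+1)%N.
rewrite [X in _ = _ + (cos X - _)](_ : _ = (2 * q).+1%:R * t + psi); last first.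
  by rewrite -[(2 * q).+1%:R]natr1 -[q.+1%:R]natr1 natrM; ring.
rewrite [X in _ = _ + (_ - cos X)](_ : _ = (2 * q.+1).+1%:R * t + psi); first by ring.
by rewrite -[(2 * q.+1).+1%:R]natr1 natrM; ring.
Qed.

Lemma continuous_le0_right (g : R -> R) (c : R) : 0 < c -> continuous g ->
  (forall t, 0 < t < c -> g t <= 0) -> g 0 <= 0.
Proof.
move=> c0 cg gle; rewrite leNgt; apply/negP => g0.
have /nbhs_ballP[e /= e0 He] : nbhs (0 : R) [set u | 0 < g u].
  exact: cvgr_gt (g 0) (cg 0) 0 g0.
pose t := Num.min (e / 2) (c / 2).
have t0 : 0 < t by rewrite lt_min !divr_gt0.
have := He t; rewrite /ball /= sub0r normrN gtr0_norm//.
have te : t < e by rewrite gt_min ltr_pdivrMr// ltr_pMr// ltr1n.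
move=> /(_ te); rewrite ltNge gle// t0 /= gt_min.
by rewrite [X in _ || X]ltr_pdivrMr// ltr_pMr// ltr1n orbT.
Qed.

Lemma riesz_cos_bound (p : R -> R) t : odd_trig p -> (forall u, `|p u| <= p 0) ->
  0 <= t <= pi / m%:R -> p 0 * cos (m%:R * t) <= p t.
Proof.
move=> [h [ch ih] ph] pmax /andP[]; have mgt0 : 0 < m%:R :> R by rewrite ltr0n.
rewrite le_eqVlt => /predU1P[<- _|t0]; first by rewrite mulr0 cos0 mulr1.
rewrite le_eqVlt => /predU1P[->|tpi].
  rewrite mulrCA divff// mulr1 cospi mulrN1.
  by have := pmax (pi / m%:R); rewrite ler_norml => /andP[].
have p0 : 0 <= p 0 by apply: le_trans (pmax 0); rewrite normr_ge0.
have m1 : 1 <= m%:R :> R by rewrite ler1n.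
(* Here $c = \cos(mu)$ lies in $[0,1]$, so $p(u) - p(0)c \leq p(0)(1-c) \leq p(0)(1-c^2)$. *)
have hle u : 0 < `|u| < pi / 2 / m%:R ->
    sin u * h u <= p 0 * (sin u * dirichlet n u) ^+ 2.
  move=> /andP[u0 upi]; rewrite sin_dirichlet sin2cos2.
  have -> : sin u * h u = p u - p 0 * cos (m%:R * u) by rewrite (ph u); ring.
  have pu : p u <= p 0 by apply: le_trans (pmax u); rewrite ler_norm.
  have cu : 0 <= cos (m%:R * u).
    apply: cos_ge0_pihalf; rewrite -ler_norml normrM gtr0_norm//.
    by rewrite mulrC -ler_pdivlMr// ltW.
  have cu1 := cos_le1 (m%:R * u).
  set c := cos _ in cu cu1 *.
  have : 0 <= p 0 * ((1 - c) * c) by rewrite !mulr_ge0// subr_ge0.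
  by nra.
have sin_pos u : 0 < u < pi / 2 / m%:R -> 0 < sin u.
  move=> /andP[u0 upi]; apply: sin_gt0_pi; rewrite u0 (lt_le_trans upi)//.
  rewrite ler_pdivrMr// ler_pM ?pi_ge0//; lra.
(* The bound [hle] is quadratic in [sin u]: dividing by [sin u] and letting [u] tend to 0 from the
   right gives [h 0 <= 0], from the left [h 0 >= 0]. *)
have h0 : h 0 = 0.
  have [cD _] := interpolates_dirichlet.
  pose g u := h u - p 0 * sin u * dirichlet n u ^+ 2.
  have cg : continuous g.
    move=> u; apply: cvgB; first exact: ch.
    apply: cvgM; last by apply: cvgM; exact: cD.
    by apply: cvgM; [exact: cvg_cst|exact: continuous_sin].
  have g0 : g 0 = h 0 by rewrite /g sin0 mulr0 mul0r subr0.
  have c0 : 0 < pi / 2 / m%:R :> R by rewrite !divr_gt0 ?pi_gt0.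
  apply/eqP; rewrite eq_le; apply/andP; split.
    rewrite -g0; apply: (continuous_le0_right c0 cg) => u u0.
    have su := sin_pos _ u0.
    rewrite subr_le0 -(ler_pM2l su) (le_trans (hle u _))//.
      by rewrite gtr0_norm//; case/andP: u0.
    by rewrite le_eqVlt; apply/orP; left; apply/eqP; ring.
  rewrite -oppr_le0 -g0 -[in g 0]oppr0.
  apply: (continuous_le0_right (g := fun u => - g (- u)) c0) => [u|u u0].
    apply: cvgN; apply: (@continuous_comp _ _ _ -%R g); last exact: cg.
    exact: oppr_continuous.
  have su := sin_pos _ u0.
  rewrite oppr_le0 subr_ge0 -(ler_pM2l su).
  have := hle (- u) _; rewrite normrN gtr0_norm; last by case/andP: u0.
  move=> /(_ u0); rewrite sinN; set D := dirichlet _ _; set H := h _.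
  by move=> hle'; nra.
have st : 0 < sin t.
  apply: sin_gt0_pi; rewrite t0 (lt_le_trans tpi)// ler_pdivrMr//.
  by rewrite ler_peMr ?pi_ge0.
have smt : 0 <= sin (m%:R * t).
  apply/ltW/sin_gt0_pi; rewrite mulr_gt0//= mulrC -ltr_pdivlMr//.
rewrite (ph t) lerDl mulr_ge0 ?(ltW st)//.
rewrite -(pmulr_rge0 _ mgt0) ih sumr_ge0// => -[[|k] km] _ /=.
  by rewrite !mul0r h0 mul0r.
set tk := _ * pi / _.
have tkpi : 0 < tk < pi.
  rewrite divr_gt0 ?mulr_gt0 ?pi_gt0 ?ltr0n//= ltr_pdivrMr// mulrC.
  by rewrite ltr_pM2l ?pi_gt0// ltr_nat.
have stk : 0 < sin tk by apply: sin_gt0_pi.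
have ttk : 0 < sin (tk - t).
  apply: sin_gt0_pi; rewrite subr_gt0 ltrBlDr.
  case/andP: tkpi => _ tkpi; rewrite (lt_trans tkpi) ?ltrDl// andbT.
  rewrite (lt_le_trans tpi)// ler_pM2r ?invr_gt0// ler_peMl ?pi_ge0//.
  by rewrite ler1n.
(* Multiplied by these positive sines, the term becomes $p(t_k) - (-1)^k p(0)$ times
   $-(-1)^k\sin(mt)$, with $k$ the index of the node. The first factor has the sign of $-(-1)^k$
   because $|p| \leq p(0)$. *)
rewrite -(pmulr_rge0 _ stk) -(pmulr_rge0 _ ttk).
have hk : sin tk * h tk = p tk - p 0 * (-1) ^+ k.+1.
  rewrite (ph tk) [X in cos X](_ : _ = 0 + k.+1%:R * pi).
    by rewrite cosDnpi cos0; ring.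
  by rewrite /tk add0r mulrC divfK.
have Dk : sin (tk - t) * dirichlet n (t - tk) = - ((-1) ^+ k.+1 * sin (m%:R * t)).
  rewrite -opprB sinN mulNr sin_dirichlet; congr (- _).
  rewrite -(signrMK k.+1 (sin _)); congr (_ * _).
  rewrite -sinDnpi; congr sin; rewrite /tk mulrBr [m%:R * (_ / _)]mulrC divfK//.
  by rewrite subrK.
rewrite [X in _ <= X](_ : _ = (sin tk * h tk) * (sin (tk - t) * dirichlet n (t - tk))); last first.
  by rewrite [RHS]mulrACA mulrA [_ * sin tk]mulrC.
rewrite hk Dk.
have := pmax tk; rewrite ler_norml => /andP[p1 p2].
rewrite -signr_odd; case: (odd _); rewrite ?expr0 ?expr1 ?mulN1r ?mul1r ?mulr1 ?mulrN1.
  by rewrite opprK mulr_ge0//; lra.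
by rewrite mulrN -mulNr mulr_ge0//; lra.
Qed.

End Interpolation.
End TrigSums.

(** * Subdivisions of the cross-polytope *)

Section Mesh.
Context {R : realType} {K : nat}.
Local Notation V := 'rV[R]_K.
Implicit Types (s q : seq V) (v w : V).

Definition bary s : V := (size s)%:R^-1 *: \sum_(v <- s) v.

Lemma bary_opp s : bary (map -%R s) = - bary s.
Proof. by rewrite /bary size_map big_map sumrN scalerN. Qed.

Lemma bary_coord s (i : 'I_K) :
  bary s 0 i = (size s)%:R^-1 * \sum_(v <- s) v 0 i.
Proof. by rewrite mxE summxE. Qed.

Lemma dotv_bary (a : V) s : (0 < size s)%N ->
  {in s, forall v, dotv a v = 1} -> dotv a (bary s) = 1.
Proof.
move=> s0 sa; rewrite dotvZr.
have -> : dotv a (\sum_(v <- s) v) = \sum_(v <- s) dotv a v.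
  rewrite /dotv exchange_big; apply: eq_bigr => i _.
  by rewrite summxE mulr_sumr.
rewrite big_seq (eq_bigr (fun=> 1)); last by move=> v /sa.
rewrite -big_seq big_const_seq count_predT iter_addr_0.
by rewrite mulVf// pnatr_eq0 -lt0n.
Qed.

Lemma bary_ball (c : R) (i : 'I_K) (r : R) s : (0 < size s)%N ->
  {in s, forall v, `|c - v 0 i| <= r} -> `|c - bary s 0 i| <= r.
Proof.
move=> s0 sr; have s1 : (size s)%:R != 0 :> R by rewrite pnatr_eq0 -lt0n.
have -> : c - bary s 0 i = (size s)%:R^-1 * \sum_(v <- s) (c - v 0 i).
  rewrite big_split /= sumrN mulrBr -mulrN bary_coord mulrN; congr (_ - _).
  by rewrite big_const_seq count_predT iter_addr_0 -[c *+ size s]mulr_natr mulrCA mulVf ?mulr1.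
rewrite normrM gtr0_norm ?invr_gt0 ?ltr0n// ler_pdivrMl ?ltr0n//.
rewrite (le_trans (ler_norm_sum _ _ _))// big_seq (le_trans (ler_sum _ sr))//.
by rewrite -big_seq big_const_seq count_predT iter_addr_0 mulr_natl.
Qed.

(** The vertex [v] itself contributes 0 to the average, which leaves [(size s).-1] terms out of
    [size s]. *)
Lemma bary_vertex (i : 'I_K) (r : R) s v : v \in s ->
    {in s &, forall v w, `|v 0 i - w 0 i| <= r} ->
  `|bary s 0 i - v 0 i| <= (size s).-1%:R / (size s)%:R * r.
Proof.
move=> vs sr; have s0 : (0 < size s)%N by case: s vs {sr}.
have s1 : (size s)%:R != 0 :> R by rewrite pnatr_eq0 -lt0n.
have -> : bary s 0 i - v 0 i = (size s)%:R^-1 * \sum_(w <- s) (w 0 i - v 0 i).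
  rewrite big_split /= mulrDr bary_coord; congr (_ + _).
  by rewrite big_const_seq count_predT iter_addr_0 -[- v 0 i *+ size s]mulr_natr mulrCA mulVf ?mulr1.
rewrite normrM gtr0_norm ?invr_gt0 ?ltr0n// ler_pdivrMl ?ltr0n//.
rewrite (le_trans (ler_norm_sum _ _ _))//.
rewrite mulrA mulrCA divff// mulr1 (perm_big _ (perm_to_rem vs)) big_cons /=.
rewrite subrr normr0 add0r big_seq.
apply: (@le_trans _ _ (\sum_(w <- rem v s | w \in rem v s) r)).
  by apply: ler_sum => w /mem_rem ws; exact: sr.
by rewrite -big_seq big_const_seq count_predT iter_addr_0 size_rem// mulr_natl.
Qed.

Lemma sd_ball (c : R) (i : 'I_K) (r : R) k s q : size s = k ->
    q \in sd bary k s -> {in s, forall v, `|c - v 0 i| <= r} ->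
  {in q, forall v, `|c - v 0 i| <= r}.
Proof.
elim: k s q => [|k IH] s q sk /=; first by rewrite inE => /eqP ->.
case/mapP => p /flattenP[d /mapP[t ts ->]] pt -> sr v.
rewrite inE => /predU1P[->|]; first by apply: bary_ball; rewrite ?sk.
apply: (IH t p) => // [|w /(mem_bd ts) /sr//].
by apply/succn_inj; rewrite (size_bd ts).
Qed.

Lemma sd_dotv (a : V) k s q : size s = k ->
    q \in sd bary k s -> {in s, forall v, dotv a v = 1} ->
  {in q, forall v, dotv a v = 1}.
Proof.
elim: k s q => [|k IH] s q sk /=; first by rewrite inE => /eqP ->.
case/mapP => p /flattenP[d /mapP[t ts ->]] pt -> sr v.
rewrite inE => /predU1P[->|]; first by apply: dotv_bary; rewrite ?sk.
apply: (IH t p) => // [|w /(mem_bd ts) /sr//].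
by apply/succn_inj; rewrite (size_bd ts).
Qed.

Lemma ratio_le (j k : nat) : (j <= k)%N ->
  j%:R / j.+1%:R <= k%:R / k.+1%:R :> R.
Proof.
move=> jk; rewrite ler_pdivrMr ?ltr0n// mulrAC ler_pdivlMr ?ltr0n//.
by rewrite -!natrM ler_nat !mulnS mulnC leq_add2r.
Qed.

Lemma sd_mesh (k j : nat) (i : 'I_K) (r : R) s q : 0 <= r -> size s = j ->
    (j <= k.+1)%N -> q \in sd bary j s ->
    {in s &, forall v w, `|v 0 i - w 0 i| <= r} ->
  {in q &, forall v w, `|v 0 i - w 0 i| <= k%:R / k.+1%:R * r}.
Proof.
move=> r0; elim: j s q => [|j IH] s q sj jk /=.
  by move: sj; case: s => // _; rewrite inE => /eqP ->.
case/mapP => p /flattenP[d /mapP[t ts ->]] pt -> sr.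
have tj : size t = j by apply/succn_inj; rewrite (size_bd ts).
have bt : {in p, forall v, `|bary s 0 i - v 0 i| <= k%:R / k.+1%:R * r}.
  apply: (sd_ball tj pt) => v /(mem_bd ts) vs.
  rewrite (le_trans (bary_vertex vs sr))// sj ler_wpM2r//; exact: ratio_le.
have pp := IH _ _ tj (ltnW jk) pt (sub_in2 (mem_bd ts) sr).
move=> v w; rewrite !inE => /predU1P[->|vp] /predU1P[->|wp].
- by rewrite subrr normr0 !mulr_ge0.
- exact: bt.
- by rewrite distrC; exact: bt.
- exact: pp.
Qed.

Lemma iter_sd_mesh (N k : nat) (i : 'I_K) (r : R) c : 0 <= r ->
    (forall s, s \in c -> size s = k.+1 /\
      {in s &, forall v w, `|v 0 i - w 0 i| <= r}) ->
  forall q, q \in iter N (sdC bary k.+1) c ->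
  {in q &, forall v w, `|v 0 i - w 0 i| <= (k%:R / k.+1%:R) ^+ N * r}.
Proof.
move=> r0 H; elim: N => [|N IH] q /=.
  by move=> /H[_ qr]; rewrite expr0 mul1r.
case/flattenP => d /mapP[t tN ->] qt; rewrite exprS -mulrA.
apply: (sd_mesh _ _ (leqnn _) qt (IH _ tN)).
  by rewrite mulr_ge0// exprn_ge0// divr_ge0.
by apply: allsize_iter_sdC tN => s /H[].
Qed.

Lemma iter_sd_dotv (N k : nat) c :
    (forall s, s \in c -> size s = k /\
      exists2 a : V, (forall i, `|a 0 i| <= 1) & {in s, forall v, dotv a v = 1}) ->
  forall q, q \in iter N (sdC bary k) c ->
  exists2 a : V, (forall i, `|a 0 i| <= 1) & {in q, forall v, dotv a v = 1}.
Proof.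
move=> H; elim: N => [|N IH] q /=; first by move=> /H[].
case/flattenP => d /mapP[t tN ->] qt; have [a a1 ta] := IH _ tN.
exists a => //; apply: (sd_dotv _ qt ta).
by apply: allsize_iter_sdC tN => s /H[].
Qed.

End Mesh.

Section CrossPolytope.
Context {R : realType} {K : nat}.
Local Notation V := 'rV[R]_K.+1.

Definition base_vec (k : nat) : V := delta_mx 0 (inord k).

Lemma base_vecE k (i : 'I_K.+1) : (k <= K)%N ->
  base_vec k 0 i = ((i : nat) == k)%:R.
Proof.
by move=> kK; rewrite mxE eqxx /= -val_eqE /= inordK.
Qed.

Lemma dotv_base_vec (a : V) k : (k <= K)%N -> dotv a (base_vec k) = a 0 (inord k).
Proof.
move=> kK; rewrite /dotv (bigD1 (inord k)) //= base_vecE// inordK// eqxx mulr1.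
rewrite big1 ?addr0// => i ik; rewrite base_vecE//.
by move: ik; rewrite -val_eqE /= inordK// => /negbTE ->; rewrite mulr0.
Qed.

(* Each face of the cross-polytope lies in a hyperplane [dotv a v = 1] where all
   coordinates of [a] are at most [1] in absolute value. *)
Lemma hemi_face k s : (k <= K)%N -> s \in hemi -%R base_vec k ->
  [/\ exists2 a : V, (forall i, `|a 0 i| <= 1) & {in s, forall v, dotv a v = 1},
      {in s, forall (v : V) (i : 'I_K.+1), (k < i)%N -> v 0 i = 0} &
      {in s, forall (v : V) (i : 'I_K.+1), `|v 0 i| <= 1}].
Proof.
elim: k s => [|k IH] s kK.
  rewrite inE => /eqP ->; split.
  - exists (base_vec 0) => [i|v].
      by rewrite base_vecE//; case: (_ == _); rewrite ?normr0 ?normr1.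
    rewrite inE => /eqP ->; rewrite dotv_base_vec// base_vecE// inordK// eqxx//.
  - by move=> v; rewrite inE => /eqP -> i i0; rewrite base_vecE// gtn_eqF.
  - move=> v; rewrite inE => /eqP -> i.
    by rewrite base_vecE//; case: (_ == _); rewrite ?normr0 ?normr1.
have {}IH q : q \in hemi -%R base_vec k ++ chT -%R (hemi -%R base_vec k) ->
    [/\ exists2 a : V, (forall i, `|a 0 i| <= 1) & {in q, forall v, dotv a v = 1},
      {in q, forall (v : V) (i : 'I_K.+1), (k < i)%N -> v 0 i = 0} &
      {in q, forall (v : V) (i : 'I_K.+1), `|v 0 i| <= 1}].
  rewrite mem_cat => /orP[/IH|/mapP[p /IH]]; first by apply; exact: ltnW.
  move=> /(_ (ltnW kK))[[a a1 ap] p0 p1] ->; split.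
  - exists (- a) => [i|v /mapP[w wp ->]]; first by rewrite mxE normrN.
    by rewrite -scaleN1r -[- w]scaleN1r dotvZl dotvZr ap// mulr1 mulrNN mulr1.
  - by move=> v /mapP[w wp ->] i ki; rewrite mxE (p0 w)// oppr0.
  - by move=> v /mapP[w wp ->] i; rewrite mxE normrN p1.
case/mapP => q /IH[[a a1 aq] q0 q1] ->; split.
(* The base vanishes at coordinate [k.+1], so setting that entry of [a] to 1 only serves to include
   the apex. *)
- exists (\row_i if (i : nat) == k.+1 then 1 else a 0 i) => [i|v].
    by rewrite mxE; case: ifP => _//; rewrite normr1.
  rewrite inE => /predU1P[->|vq].
    by rewrite dotv_base_vec// mxE inordK// eqxx.
  rewrite -[RHS](aq v vq); apply: eq_bigr => i _; rewrite mxE.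
  by case: ifP => // /eqP ik; rewrite (q0 v)// ?ik// !mulr0.
- move=> v; rewrite inE => /predU1P[->|vq] i ki.
    by rewrite base_vecE// gtn_eqF.
  by rewrite (q0 v)// ltnW.
- move=> v; rewrite inE => /predU1P[->|vq] i; last exact: q1.
  by rewrite base_vecE//; case: (_ == _); rewrite ?normr0 ?normr1.
Qed.

(** Cauchy-Schwarz with [a]. It keeps the vertices away from the origin, where radial projection is
    not defined. *)
Lemma dotv_face (a v : V) : (forall i, `|a 0 i| <= 1) -> dotv a v = 1 ->
  K.+1%:R^-1 <= dotv v v.
Proof.
move=> a1 av; have := dotv_CauchySchwarz a v; rewrite av expr1n.
have : dotv a a <= K.+1%:R.
  apply: (@le_trans _ _ (\sum_(i < K.+1) 1)).
    apply: ler_sum => i _; rewrite -expr2 -real_normK ?num_real//.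
    by rewrite expr_le1.
  by rewrite sumr_const card_ord.
move=> aK aav; rewrite -[leLHS]mul1r ler_pdivrMr ?ltr0n// mulrC.
by rewrite (le_trans aav)// ler_wpM2r// dotv_ge0.
Qed.

End CrossPolytope.

(** * Antipodes and radial projection *)

Section SphereBasics.
Context {R : realType} {K : nat}.
Local Notation S := (sphere R K).
Implicit Types x y : S.

Lemma sphere_dotvP (v : 'rV[R]_K.+1) : dotv v v = 1 ->
  \sum_(i < K.+1) v 0 i ^+ 2 == 1.
Proof. by move=> <-; apply/eqP/eq_bigr => i _; rewrite expr2. Qed.

Lemma dotvNl (v w : 'rV[R]_K.+1) : dotv (- v) w = - dotv v w.
Proof. by rewrite -scaleN1r dotvZl mulN1r. Qed.

Lemma dotvNr (v w : 'rV[R]_K.+1) : dotv v (- w) = - dotv v w.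
Proof. by rewrite dotvC dotvNl dotvC. Qed.

Lemma antipode_subproof x : dotv (- (x : 'rV_K.+1)) (- (x : 'rV_K.+1)) = 1.
Proof. by rewrite dotvNl dotvNr opprK dotv_sphere. Qed.

Definition antipode x : S := Sphere (sphere_dotvP (antipode_subproof x)).

Lemma antipodeK : involutive antipode.
Proof. by move=> x; apply/val_inj; rewrite /= opprK. Qed.

Lemma antipode_neq x : antipode x != x.
Proof.
apply/eqP => /(congr1 (fun y : S => dotv (y : 'rV_K.+1) x)) /=.
by rewrite dotvNl dotv_sphere; lra.
Qed.

Lemma mdist_antipode x y : mdist (antipode x) y = pi - mdist x y.
Proof. by rewrite /mdist /= /geodesic_dist dotvNl acosN// dotv_sphere_bound. Qed.

Lemma mdist_antipode2 x y : mdist (antipode x) (antipode y) = mdist x y.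
Proof. by rewrite mdist_antipode metric_sym mdist_antipode metric_sym; lra. Qed.

Lemma sphere_pole_subproof : dotv (base_vec 0 : 'rV[R]_K.+1) (base_vec 0) = 1.
Proof. by rewrite dotv_base_vec// base_vecE// inordK// eqxx. Qed.

Definition sphere_pole : S := Sphere (sphere_dotvP sphere_pole_subproof).

(* The junk value [sphere_pole] is taken at [v = 0]. *)
Definition radial (v : 'rV[R]_K.+1) : S :=
  insubd sphere_pole ((Num.sqrt (dotv v v))^-1 *: v).

Lemma radialE (v : 'rV[R]_K.+1) : 0 < dotv v v ->
  radial v = (Num.sqrt (dotv v v))^-1 *: v :> 'rV_K.+1.
Proof.
move=> v0; rewrite /radial insubdK//; apply: sphere_dotvP.
rewrite dotvZl dotvZr mulrA -expr2 exprVn sqr_sqrtr ?ltW//.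
by rewrite mulVf// gt_eqF.
Qed.

Lemma radial_opp (v : 'rV[R]_K.+1) : 0 < dotv v v ->
  radial (- v) = antipode (radial v).
Proof.
by move=> v0; apply/val_inj; rewrite /= !radialE ?dotvNl ?dotvNr ?opprK// scalerN.
Qed.

Lemma mdist_le_cos x y (e : R) : 0 <= e <= pi -> cos e <= dotv x y ->
  mdist x y <= e.
Proof.
move=> e01; rewrite -cos_geodesic_dist => ce.
rewrite -[mdist x y]/(geodesic_dist x y) leNgt -ltr_cos ?in_itv//=.
  by rewrite -leNgt.
exact: geodesic_dist_bound.
Qed.

(** For $A = |v|$, $B = |w|$ and $P = \langle v,w\rangle$, one has $2AB - 2P \leq |v-w|^2 \leq
    (K+1)r^2$ and $AB \geq 1/(K+1)$, which bounds $1 - P/(AB)$. *)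
Lemma radial_close (e r : R) (v w : 'rV[R]_K.+1) : 0 <= e <= pi ->
    K.+1%:R ^+ 2 * r ^+ 2 / 2 <= 1 - cos e ->
    K.+1%:R^-1 <= dotv v v -> K.+1%:R^-1 <= dotv w w ->
    (forall i, `|v 0 i - w 0 i| <= r) ->
  mdist (radial v) (radial w) <= e.
Proof.
move=> e01 re vv ww vw.
have k0 : 0 < K.+1%:R^-1 :> R by rewrite invr_gt0 ltr0n.
have v0 := lt_le_trans k0 vv; have w0 := lt_le_trans k0 ww.
apply: mdist_le_cos => //; rewrite !radialE// dotvZl dotvZr.
set A := Num.sqrt _; set B := Num.sqrt _; set P := dotv v w.
have A0 : 0 < A by rewrite sqrtr_gt0.
have B0 : 0 < B by rewrite sqrtr_gt0.
have A2 : A ^+ 2 = dotv v v by rewrite sqr_sqrtr ?ltW.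
have B2 : B ^+ 2 = dotv w w by rewrite sqr_sqrtr ?ltW.
have AB : K.+1%:R^-1 <= A * B.
  rewrite -(ler_pXn2r (n := 2)) ?nnegrE ?mulr_ge0 ?(ltW A0) ?(ltW B0) ?(ltW k0)//.
  by rewrite exprMn A2 B2 expr2 ler_pM// (ltW k0).
have D : dotv (v - w) (v - w) = A ^+ 2 + B ^+ 2 - 2 * P.
  by rewrite A2 B2 dotvDl !dotvDr !dotvNl !dotvNr (dotvC w v) /P; ring.
have Dr : dotv (v - w) (v - w) <= K.+1%:R * r ^+ 2.
  apply: (@le_trans _ _ (\sum_(i < K.+1) r ^+ 2)); last first.
    by rewrite sumr_const card_ord mulr_natl.
  apply: ler_sum => i _; rewrite !mxE -expr2 -real_normK ?num_real//.
  rewrite ler_pXn2r// ?nnegrE ?normr_ge0//.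
  by rewrite (le_trans (normr_ge0 _) (vw i)).
have ABp : 0 < A * B by rewrite mulr_gt0.
rewrite mulrA -invfM mulrC ler_pdivlMr//.
have : 2 * (A * B) - 2 * P <= K.+1%:R * r ^+ 2.
  by apply: le_trans Dr; rewrite D; have := sqr_ge0 (A - B); nra.
have : K.+1%:R * r ^+ 2 <= (1 - cos e) * 2 * (A * B).
  have re' : K.+1%:R ^+ 2 * r ^+ 2 <= (1 - cos e) * 2 by rewrite -ler_pdivrMr.
  apply: le_trans (ler_wpM2r (ltW ABp) re').
  have -> : K.+1%:R ^+ 2 * r ^+ 2 * (A * B) =
      (K.+1%:R * r ^+ 2) * (K.+1%:R * (A * B)) by ring.
  have Kr : 0 <= K.+1%:R * r ^+ 2 by apply: mulr_ge0; rewrite ?sqr_ge0.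
  rewrite ler_peMr//.
  by rewrite mulrC -ler_pdivrMr ?ltr0n// mul1r.
by nra.
Qed.

End SphereBasics.

(** * The lower bound *)

Section LowerBound.
Context {R : realType}.
Local Notation C := (sphere R 1).

Lemma dotv_circle (p q : C) :
  dotv p q = (p : 'rV_2) 0 0 * (q : 'rV_2) 0 0 +
             (p : 'rV_2) 0 1 * (q : 'rV_2) 0 1.
Proof. by rewrite /dotv big_ord_recl big_ord_recl big_ord0 addr0; congr (_ + _ * _);
  congr (fun_of_matrix _ _ _); apply/val_inj. Qed.

Definition at_angle (p : C) (t : R) :=
  (p : 'rV_2) 0 0 = cos t /\ (p : 'rV_2) 0 1 = sin t.

Lemma circle_half_angle (p : C) : exists tb : R * bool, 0 <= tb.1 < pi /\
  at_angle (if tb.2 then p else antipode p) tb.1.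
Proof.
have up (q : C) : 0 <= (q : 'rV_2) 0 1 -> at_angle q (acos ((q : 'rV_2) 0 0)).
  move=> q1; have := dotv_sphere q; rewrite dotv_circle => qq.
  have q0 : -1 <= (q : 'rV_2) 0 0 <= 1.
    by rewrite -ler_norml -(@expr_le1 _ 2)// real_normK ?num_real// -qq; nra.
  split; first by rewrite acosK.
  rewrite sin_acos// -[LHS]ger0_norm// -sqrtr_sqr; congr Num.sqrt.
  by rewrite -qq; ring.
have [p1|p1] := leP 0 ((p : 'rV_2) 0 1).
  have [c s] := up p p1; set t := acos _ in c s.
  have := dotv_sphere p; rewrite dotv_circle => pp.
  have p0 : -1 <= (p : 'rV_2) 0 0 <= 1.
    by rewrite -ler_norml -(@expr_le1 _ 2)// real_normK ?num_real// -pp; nra.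
  (* Angle [pi] is outside the range; the antipode then has angle 0. *)
  have [tpi|tpi] := ltP t pi.
    by exists (t, true); rewrite /= acos_ge0.
  have {}tpi : t = pi by apply/eqP; rewrite eq_le tpi acos_lepi.
  rewrite tpi cospi sinpi in c s.
  by exists (0, false); rewrite /at_angle /= lexx pi_gt0 !mxE c s cos0 sin0 opprK oppr0.
have q1 : 0 <= (antipode p : 'rV_2) 0 1 by rewrite mxE oppr_ge0 ltW.
have [c s] := up _ q1; set t := acos _ in c s.
have := dotv_sphere (antipode p); rewrite dotv_circle => pp.
have p0 : -1 <= (antipode p : 'rV_2) 0 0 <= 1.
  by rewrite -ler_norml -(@expr_le1 _ 2)// real_normK ?num_real// -pp; nra.
exists (t, false); rewrite /= acos_ge0//; split => //=.
rewrite lt_neqAle acos_lepi// andbT; apply/eqP => tpi.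
by move: s; rewrite tpi sinpi mxE => /eqP; rewrite oppr_eq0 lt_eqF.
Qed.

Lemma dotv_at_angle (p q : C) (t u : R) : at_angle p t -> at_angle q u ->
  dotv p q = cos (t - u).
Proof. by move=> [p0 p1] [q0 q1]; rewrite dotv_circle p0 p1 q0 q1 cosB. Qed.

Lemma altb_nth b w i : altb b w -> (i < size w)%N -> nth false w i = b (+) odd i.
Proof.
elim: w b i => [//|x w IH] b [|i] /= /andP[/eqP xb aw] iw; first by rewrite xb addbF.
by rewrite (IH _ _ aw)// addNb addbN.
Qed.

Lemma cos_pi_div_lt (m : nat) (t : R) : (0 < m)%N -> 0 <= t <= pi ->
  - cos (pi / m%:R) < cos t -> t < pi - pi / m%:R.
Proof.
move=> m0 t01; have pm : 0 <= (pi : R) - pi / m%:R <= pi.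
  rewrite gerBl divr_ge0 ?pi_ge0// andbT subr_ge0.
  by rewrite ler_pdivrMr ?ltr0n// ler_peMr ?pi_ge0// ler1n.
rewrite (_ : - cos _ = cos (pi - pi / m%:R)); last first.
  by rewrite cosB cospi sinpi; ring.
by rewrite ltr_cos ?in_itv.
Qed.

(* Consecutive points of an alternating set are nearly antipodal, so their
   positions differ by more than [pi / m]; the extreme ones then contradict the
   hypothesis. *)
Lemma alternating_gap (n : nat) (w : seq (R * bool)) (b : bool) :
    (0 < n)%N -> size w = (2 * n).+1 -> sorted (@lel _ R) w ->
    altb b (map snd w) ->
    {in w, forall p, 0 <= p.1 < pi} ->
    {in w &, forall p q, - cos (pi / (2 * n).+1%:R) <
       (-1) ^+ (p.2 (+) q.2) * cos (p.1 - q.1)} ->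
  False.
Proof.
move=> n0 sw /(sortedP (0, false)) srt aw w01 wc; set m := (2 * n).+1 in sw wc *.
have m0 : 0 < m%:R :> R by rewrite ltr0n.
pose t i := (nth (0, false) w i).1.
have mem i : (i < m)%N -> nth (0, false) w i \in w by move=> im; rewrite mem_nth ?sw.
have sg i : (i < m)%N -> (nth (0, false) w i).2 = b (+) odd i.
  by move=> im; rewrite -(altb_nth aw) ?size_map ?sw// (nth_map (0, false)) ?sw.
have step i : (i.+1 < m)%N -> pi / m%:R <= t i.+1 - t i.
  move=> im; have im' := ltnW im.
  have le_t : t i <= t i.+1.
    by rewrite /t; have := srt i; rewrite sw => /(_ im) /orP[/ltW//|/andP[/eqP-> _]].
  have /andP[ti0 tipi] := w01 _ (mem i im').
  have /andP[tj0 tjpi] := w01 _ (mem _ im).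
  rewrite -/(t _) in ti0 tipi tj0 tjpi.
  have := wc _ _ (mem _ im) (mem _ im'); rewrite !sg//= -!/(t _).
  rewrite addbACA addbb addNb addbb expr1 mulN1r ltrN2 => cc.
  rewrite ltW// -ltr_cos// in_itv/=; last lra.
  rewrite divr_ge0 ?pi_ge0//= ler_pdivrMr// ler_peMr ?pi_ge0// ler1n//.
have gap i : (i < m)%N -> i%:R * (pi / m%:R) <= t i - t 0.
  elim: i => [|i IH] im; first by rewrite mul0r subrr.
  have := step i im; have := IH (ltnW im).
  by rewrite -[i.+1%:R]natr1; lra.
have m1 : (2 * n < m)%N by [].
have /andP[t00 t0pi] := w01 _ (mem 0 (ltn0Sn _)).
have /andP[tn0 tnpi] := w01 _ (mem _ m1).
rewrite -/(t _) in t00 t0pi tn0 tnpi.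
(* The extreme signs agree since [2 * n] is even, so the extreme angles differ by less than $\pi -
   \pi/m$, whereas $2n$ gaps of $\pi/m$ add up to exactly that. *)
have := wc _ _ (mem _ m1) (mem 0 (ltn0Sn _)); rewrite !sg//= -!/(t _).
rewrite addbACA addbb oddM /= expr0 mul1r.
have tn := gap _ m1.
move=> cc; have tle : 0 <= t (2 * n)%N - t 0.
  by apply: le_trans tn; rewrite mulr_ge0// divr_ge0 ?pi_ge0.
have : t (2 * n)%N - t 0 < pi - pi / m%:R.
  by apply: cos_pi_div_lt => //; rewrite tle /=; lra.
rewrite ltNge => /negP; apply.
apply: le_trans tn; rewrite le_eqVlt; apply/orP; left; apply/eqP.
have -> : (2 * n)%:R = m%:R - 1 :> R by rewrite -[m%:R]natr1 addrK.
by field; rewrite gt_eqF.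
Qed.

(** * Maps from the sphere to the circle *)

Section Distortion.
Variables (n : nat) (delta : R).
Hypothesis n0 : (0 < n)%N.
Let K := (2 * n + 1)%N.
Let m := (2 * n).+1.
Local Notation S := (sphere R K).
Variable g : S -> C.
Hypothesis dis_g : forall x y, `|mdist (g x) (g y) - mdist x y| <= delta.

(** Selecting from the pair as a set gives [x] and its antipode the same representative; the set is
    nonempty, so the default is not reached. *)
Definition rep (x : S) : S := xget (sphere_pole : S) [set y | y = x \/ y = antipode x].

Lemma rep_or x : rep x = x \/ rep x = antipode x.
Proof.
have := @xgetPex _ (sphere_pole : S) [set y | y = x \/ y = antipode x].
by apply; exists x; left.
Qed.

Lemma rep_antipode x : rep (antipode x) = rep x.
Proof.
congr xget; apply/seteqP; split => y /=; rewrite antipodeK; tauto.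
Qed.

(* The odd modification of [g]: it agrees with [g] on one point of each
   antipodal pair. *)
Definition oddg (x : S) : C :=
  if x == rep x then g (rep x) else antipode (g (rep x)).

(** Passing to the antipode of one point replaces both distances $d$ by $\pi - d$. *)
Lemma dis_oddg x y : `|mdist (oddg x) (oddg y) - mdist x y| <= delta.
Proof.
have E (z : S) : z = if z == rep z then rep z else antipode (rep z).
  case: eqP => // zr; case: (rep_or z) => [/esym//|->]; by rewrite antipodeK.
rewrite [in X in _ - X](E x) [in X in _ - X](E y) /oddg.
have F (a b : R) : `|(pi - a) - (pi - b)| = `|a - b|.
  by rewrite distrC; congr (`|_|); ring.
have := dis_g (rep x) (rep y).
case: (x == rep x); case: (y == rep y); rewrite ?mdist_antipode2//.
  by rewrite ![mdist _ (antipode _)]metric_sym !mdist_antipode F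
    ![mdist _ (_ (rep x))]metric_sym ![mdist _ (rep x)]metric_sym.
by rewrite !mdist_antipode F.
Qed.

Definition half_angle (p : C) : R * bool := projT1 (cid (circle_half_angle p)).

Definition label_pos (x : S) : R := (half_angle (g (rep x))).1.
Definition label_sgn (x : S) : bool :=
  (x == rep x) (+) (half_angle (g (rep x))).2.

Lemma label_pos_bound x : 0 <= label_pos x < pi.
Proof. by rewrite /label_pos /half_angle; case: cid => tb []. Qed.

Lemma label_pos_antipode x : label_pos (antipode x) = label_pos x.
Proof. by rewrite /label_pos rep_antipode. Qed.

Lemma label_sgn_antipode x : label_sgn (antipode x) = ~~ label_sgn x.
Proof.
rewrite /label_sgn rep_antipode -addNb; congr (_ (+) _).
have xa := antipode_neq x; case: (rep_or x) => ->.
  by rewrite eqxx (negbTE xa).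
by rewrite eqxx eq_sym (negbTE xa).
Qed.

Lemma dotv_oddg x y : dotv (oddg x) (oddg y) =
  (-1) ^+ (label_sgn x (+) label_sgn y) * cos (label_pos x - label_pos y).
Proof.
pose h (z : S) : C := if (half_angle (g (rep z))).2 then g (rep z)
  else antipode (g (rep z)).
have hP z : at_angle (h z) (label_pos z).
  by rewrite /h /label_pos /half_angle; case: cid => tb [].
have E z : (oddg z : 'rV_2) = (-1) ^+ (label_sgn z) *: (h z : 'rV_2).
  rewrite /oddg /h /label_sgn; case: (z == rep z); case: (half_angle _).2 => /=.
  - by rewrite expr0 scale1r.
  - by rewrite expr1 scalerN scaleN1r opprK.
  - by rewrite expr1 scaleN1r.
  - by rewrite expr0 scale1r.
rewrite !E dotvZl dotvZr (dotv_at_angle (hP x) (hP y)) mulrA; congr (_ * _).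
by case: (label_sgn x); case: (label_sgn y); rewrite /= ?expr0 ?expr1; ring.
Qed.

Lemma small_power (l r : R) : 0 <= l < 1 -> 0 < r -> exists N : nat, l ^+ N <= r.
Proof.
move=> /andP[l0 l1] r0.
have : l ^+ k @[k --> \oo] --> (0 : R) by apply: cvg_expr; rewrite ger0_norm.
move=> /cvgr_lt/(_ r r0)[N _ HN]; exists N; apply/ltW/HN => /=; exact: leqnn.
Qed.

Lemma distortion_ge : pi - pi / m%:R <= delta.
Proof.
rewrite leNgt; apply/negP => dpi.
have d0 : 0 <= delta by apply: le_trans (dis_g sphere_pole sphere_pole).
have m0 : 0 < m%:R :> R by rewrite ltr0n.
have pm0 : 0 < pi / m%:R :> R by rewrite divr_gt0 ?pi_gt0.
(* Half of the slack: neighbouring points at distance at most [e] have images closer than $\pi -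
   \pi/m$. *)
pose e := (pi - pi / m%:R - delta) / 2.
have e0 : 0 < e by rewrite /e divr_gt0// subr_gt0.
have epi : e <= pi by rewrite /e; lra.
have ce : 0 < 1 - cos e.
  by rewrite subr_gt0 -cos0 ltr_cos ?in_itv//= ?lexx ?pi_ge0 ?(ltW e0).
(* A mesh size to which [radial_close] applies; [r <= 1] gives [r ^+ 2 <= r]. *)
pose r := Num.min 1 (2 * (1 - cos e) / K.+1%:R ^+ 2).
have k0 : 0 < K.+1%:R ^+ 2 :> R by rewrite exprn_gt0// ltr0n.
have r0 : 0 < r by rewrite lt_min ltr01 divr_gt0// mulr_gt0.
have rr : K.+1%:R ^+ 2 * r ^+ 2 / 2 <= 1 - cos e.
  have r1 : r <= 1 by rewrite ge_min lexx.
  have r2 : r ^+ 2 <= r by rewrite expr2 ler_piMr// ltW.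
  have rk : r <= 2 * (1 - cos e) / K.+1%:R ^+ 2 by rewrite ge_min lexx orbT.
  rewrite ler_pdivrMr// mulrC -ler_pdivlMr// [_ * 2]mulrC.
  exact: le_trans r2 rk.
(* The contraction ratio of one subdivision in dimension [2 * n]. Initial coordinates differ by at
   most 2, hence the target [r / 2] for [l ^+ N]. *)
pose l : R := (2 * n)%:R / (2 * n).+1%:R.
have l01 : 0 <= l < 1 by rewrite divr_ge0//= ltr_pdivrMr// mul1r ltr_nat.
have [N lN] := small_power l01 (divr_gt0 r0 (ltr0n _ 2)).
have lN2 j : (j <= 2 * n)%N -> (j%:R / j.+1%:R) ^+ N * 2 <= r.
  move=> jn; rewrite -ler_pdivlMr// (le_trans _ lN)//.
  rewrite lerXn2r ?nnegrE ?divr_ge0//; exact: ratio_le.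
have nK : (2 * n <= K)%N by rewrite /K addn1.
pose pos (v : 'rV[R]_K.+1) := label_pos (radial v).
pose sgn (v : 'rV[R]_K.+1) := label_sgn (radial v).
have Y j (s : seq 'rV[R]_K.+1) : (j <= 2 * n)%N ->
    s \in iter N (sdC bary j.+1) (hemi -%R base_vec j) ->
    {in s, forall v, K.+1%:R^-1 <= dotv v v} /\
    {in s &, forall v w, - cos (pi / m%:R) <
       (-1) ^+ (sgn v (+) sgn w) * cos (pos v - pos w)}.
  move=> jn sN; have jK := leq_trans jn nK.
  have sf : {in s, forall v, K.+1%:R^-1 <= dotv v v}.
    have [|a a1 sa] := iter_sd_dotv _ sN.
      move=> q qj; have [] := hemi_face jK qj; split => //.
      exact: allsize_hemi qj.
    by move=> v vs; apply: (dotv_face a1); exact: sa.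
  split=> // v w vs ws; rewrite -dotv_oddg.
  have vw : mdist (radial v) (radial w) <= e.
    apply: (radial_close _ rr) (sf _ vs) (sf _ ws) _ => [|i].
      by rewrite ltW.
    apply: le_trans (lN2 j jn); apply: iter_sd_mesh sN _ _ vs ws => // q qj.
    split; first exact: allsize_hemi qj.
    move=> x y xq yq; have [_ _ q1] := hemi_face jK qj.
    by rewrite (le_trans (ler_normB _ _))// -[2]/(1 + 1) lerD// q1.
  have := dis_oddg (radial v) (radial w); rewrite ler_norml => /andP[_ dvw].
  have : mdist (oddg (radial v)) (oddg (radial w)) < pi - pi / m%:R.
    apply: (@le_lt_trans _ _ (delta + e)); first lra.
    by rewrite /e; lra.
  rewrite -[mdist _ _]/(geodesic_dist _ _) -ltr_cos ?in_itv/=.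
  - by rewrite cos_geodesic_dist cosB cospi sinpi; lra.
  - exact: geodesic_dist_bound.
  - rewrite subr_ge0 ler_pdivrMr// ler_peMr ?pi_ge0 ?ler1n//=.
    by rewrite gerBl ltW.
have vpos j (s : seq 'rV[R]_K.+1) : (j <= 2 * n)%N ->
    s \in iter N (sdC bary j.+1) (hemi -%R base_vec j) ->
    {in s, forall v, 0 < dotv v v}.
  move=> jn sN v vs; have [/(_ _ vs) + _] := Y j s jn sN.
  by apply: lt_le_trans; rewrite invr_gt0 ltr0n.
(* Dimension [2 * n] is one less than that of the sphere: its simplices have [m] vertices. *)
have [|s sN [b ab]] := @ky_fan _ R _ pos sgn -%R bary opprK bary_opp base_vec N (2 * n).
  move=> j s jn sN; have [_ s2] := Y j s jn sN; split.
  (* Opposite signs at equal positions would give $-\cos(\pi/m) < -1$. *)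
  - move=> v w vs ws vw; have := s2 v w vs ws; rewrite vw subrr cos0 mulr1.
    case: (sgn v); case: (sgn w) => //=; rewrite expr1 ltrN2 ltNge => /negP;
      case; exact: cos_le1.
  - by move=> v vs; rewrite /pos radial_opp ?label_pos_antipode// (vpos j s).
  - by move=> v vs; rewrite /sgn radial_opp ?label_sgn_antipode// (vpos j s).
have [_ s2] := Y _ s (leqnn _) sN.
apply: (@alternating_gap n (slab pos sgn s) b) => //.
- rewrite size_sort size_map; apply: allsize_iter_sdC sN.
  exact: allsize_hemi.
- exact: sort_sorted (@lel_total _ R) _.
- by move=> p; rewrite mem_sort => /mapP[v _ ->]; exact: label_pos_bound.
- move=> p q; rewrite !mem_sort => /mapP[v vs ->] /mapP[w ws ->].
  exact: s2.
Qed.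

End Distortion.

Lemma hausdorff_dist_ge (n : nat) (Z : metricType R) (X Y : set Z) :
    (0 < n)%N ->
    isometric_copy (sphere R 1) X -> isometric_copy (sphere R (2 * n + 1)) Y ->
  ((pi * n%:R / (2 * n%:R + 1))%:E <= hausdorff_dist X Y)%E.
Proof.
move=> n0 [f1 [f1d f1X]] [f2 [f2d f2Y]]; rewrite leNgt; apply/negP.
set c := pi * n%:R / _; rewrite /hausdorff_dist gt_max => /andP[_].
set A := ereal_sup _ => Ac.
have [c' Ac' c'c] : exists2 c', (A <= c'%:E)%E & c' < c.
  move: Ac; case: A => [a| |] //; first by rewrite lte_fin => ac; exists a.
  by exists (c - 1); [rewrite leNye|lra].
pose c2 := (c' + c) / 2.
(* Choosing for every point of [Y] a point of [X] nearer than [c2] yields a map [g] of distortion at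
   most $2c_2 < 2c = \pi - \pi/m$, with $m = 2n+1$. *)
have H y : exists x, mdist (f2 y) (f1 x) < c2.
  have : (dist_to_set (f2 y) X < c2%:E)%E.
    apply: le_lt_trans (_ : (c'%:E < c2%:E)%E); last first.
      by rewrite lte_fin /c2; lra.
    apply: le_trans Ac'; apply: ereal_sup_ubound.
    by exists (f2 y) => //; rewrite -f2Y; exists y.
  move=> /ereal_inf_lt[_ [z Xz <-]]; rewrite lte_fin => zc.
  by move: Xz zc; rewrite -f1X => -[x _ <-]; exists x.
have [g gP] := choice H.
have /(distortion_ge n0) : forall x y, `|mdist (g x) (g y) - mdist x y| <= 2 * c2.
  move=> x y; rewrite -f1d -f2d ler_norml.
  have T := @metric_triangle R Z.
  have gx := gP x; have gy := gP y.
  have t1 := T (f1 (g x)) (f2 x) (f1 (g y)).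
  have t2 := T (f2 x) (f2 y) (f1 (g y)).
  have t3 := T (f2 x) (f1 (g x)) (f2 y).
  have t4 := T (f1 (g x)) (f1 (g y)) (f2 y).
  rewrite [mdist (f1 (g x)) (f2 x)]metric_sym in t1.
  rewrite [mdist (f1 (g y)) (f2 y)]metric_sym in t4.
  by apply/andP; split; lra.
apply/negP; rewrite -ltNge.
have -> : pi - pi / (2 * n).+1%:R = 2 * c.
  rewrite /c -natr1 natrM; field.
  by rewrite -natrM natr1 pnatr_eq0.
by rewrite /c2; lra.
Qed.

End LowerBound.

(** * Gluing along a correspondence *)

Section Gluing.
Context {R : realType}.

(** The conditions for [cross_dist] to extend both metrics to the disjoint union. *)
Record gluing (X Y : metricType R) := Gluing {
  cross_dist : X -> Y -> R ;
  cross_dist_gt0 : forall x y, 0 < cross_dist x y ;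
  cross_dist_l : forall x' x y, cross_dist x y <= mdist x x' + cross_dist x' y ;
  cross_dist_r : forall y' x y, cross_dist x y <= cross_dist x y' + mdist y' y ;
  mdist_cross_l : forall x x' y, mdist x x' <= cross_dist x y + cross_dist x' y ;
  mdist_cross_r : forall y y' x, mdist y y' <= cross_dist x y + cross_dist x y'
}.

(** An alias of the sum indexed by [G], so that the metric instance can depend on [G]. *)
Definition glued (X Y : metricType R) (G : gluing X Y) : Type := (X + Y)%type.

Definition glued_dist (X Y : metricType R) (G : gluing X Y) (u v : glued G) : R :=
  match u, v with
  | inl x, inl x' => mdist x x'
  | inl x, inr y | inr y, inl x => cross_dist G x y
  | inr y, inr y' => mdist y y'
  end.

Section Instance.
Variables (X Y : metricType R) (G : gluing X Y).

Lemma glued_distxx u : glued_dist (G := G) u u = 0.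
Proof. by case: u => z; exact: mdistxx. Qed.

Lemma glued_dist_positivity u v : glued_dist (G := G) u v = 0 -> u = v.
Proof.
case: u v => [x|y] [x'|y'] /=; try by move/mdist_positivity ->.
  by move=> e; have := cross_dist_gt0 G x y'; rewrite e ltxx.
by move=> e; have := cross_dist_gt0 G x' y; rewrite e ltxx.
Qed.

Lemma glued_dist_sym u v : glued_dist (G := G) u v = glued_dist v u.
Proof. by case: u v => [x|y] [x'|y'] //=; exact: metric_sym. Qed.

Lemma glued_dist_triangle v u w :
  glued_dist (G := G) u w <= glued_dist u v + glued_dist v w.
Proof.
case: u v w => [x|y] [x'|y'] [x''|y''] /=.
- exact: metric_triangle.
- exact: cross_dist_l.
- exact: mdist_cross_l.
- exact: cross_dist_r.
- by rewrite addrC metric_sym addrC [leRHS]addrC; apply: cross_dist_l.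
- exact: mdist_cross_r.
- by rewrite [leRHS]addrC metric_sym; apply: cross_dist_r.
- exact: metric_triangle.
Qed.

HB.instance Definition _ := Choice.copy (glued G) (X + Y)%type.
HB.instance Definition _ := @isMetric.Build R (glued G) (@glued_dist X Y G)
  glued_distxx glued_dist_positivity glued_dist_sym glued_dist_triangle.

End Instance.

Section Correspondence.
Variables (X Y : metricType R) (C : X -> Y -> Prop) (r : R).
Hypothesis r0 : 0 < r.
Hypothesis C_l : forall x, exists y, C x y.
Hypothesis C_r : forall y, exists x, C x y.
Hypothesis dis_C : forall x x' y y', C x y -> C x' y' ->
  `|mdist x x' - mdist y y'| <= 2 * r.

(** Lengths of paths from [x] to [y] that cross at a pair of the correspondence. A crossing costs
    [r], half the bound on the distortion, so crossing twice creates no shortcut. *)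
Let vals x y := [set d | exists p : X * Y, C p.1 p.2 /\
  d = mdist x p.1 + r + mdist p.2 y].

Let D x y : R := inf (vals x y).

Let D_le x y a b : C a b -> D x y <= mdist x a + r + mdist b y.
Proof.
move=> ab; apply: ge_inf; last by exists (a, b).
by exists 0 => _ [p [_ ->]]; rewrite !addr_ge0 ?mdist_ge0// ltW.
Qed.

Let le_D x y (d : R) : (forall a b, C a b -> d <= mdist x a + r + mdist b y) ->
  d <= D x y.
Proof.
move=> H; apply: lb_le_inf; last by move=> _ [p [pC ->]]; exact: H.
have [b xb] := C_l x; exists (mdist x x + r + mdist b y); exists (x, b); split => //.
Qed.

Lemma correspondence_gluing : exists G : gluing X Y,
  forall x y, C x y -> cross_dist G x y <= r.
Proof.
have TX := @metric_triangle R X; have TY := @metric_triangle R Y.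
have D0 x y : 0 < D x y.
  apply: lt_le_trans r0 _; apply: le_D => a b _.
  by rewrite -addrA addrCA lerDl addr_ge0 ?mdist_ge0.
have Dl x' x y : D x y <= mdist x x' + D x' y.
  rewrite -lerBlDl; apply: le_D => a b ab; rewrite lerBlDl !addrA.
  by apply: le_trans (D_le x y ab) _; rewrite !lerD2r TX.
have Dr y' x y : D x y <= D x y' + mdist y' y.
  rewrite -lerBlDr; apply: le_D => a b ab; rewrite lerBlDr -addrA.
  by apply: le_trans (D_le x y ab) _; rewrite lerD2l TY.
have dl x x' y : mdist x x' <= D x y + D x' y.
  rewrite -lerBlDr; apply: le_D => a b ab; rewrite lerBlDl -lerBlDr.
  apply: le_D => a' b' ab'; have := dis_C ab ab'; rewrite ler_norml => /andP[_].
  have := TX x a x'; have := TX a a' x'; have := TY b y b'.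
  by rewrite [mdist a' x']metric_sym [mdist y b']metric_sym; lra.
have dr y y' x : mdist y y' <= D x y + D x y'.
  rewrite -lerBlDr; apply: le_D => a b ab; rewrite lerBlDl -lerBlDr.
  apply: le_D => a' b' ab'; have := dis_C ab ab'; rewrite ler_norml => /andP[+ _].
  have := TY y b y'; have := TY b b' y'; have := TX a x a'.
  by rewrite [mdist y b]metric_sym [mdist a x]metric_sym; lra.
exists (Gluing D0 Dl Dr dl dr) => x y xy /=.
by have := D_le x y xy; rewrite !mdistxx add0r addr0.
Qed.

Lemma gromov_hausdorff_le : (gromov_hausdorff_dist X Y <= r%:E)%E.
Proof.
have [G Gr] := correspondence_gluing.
pose X' := (inl : X -> glued G) @` [set: X].
pose Y' := (inr : Y -> glued G) @` [set: Y].
apply: (@le_trans _ _ (hausdorff_dist X' Y')).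
  apply: ereal_inf_lbound; exists (glued G), X', Y'; split => //.
    by exists inl; split.
  by exists inr; split.
rewrite /hausdorff_dist ge_max; apply/andP; split.
  apply: ge_ereal_sup => _ [_ [x _ <-] <-]; have [y xy] := C_l x.
  apply: (@le_trans _ _ (mdist (inl x : glued G) (inr y))%:E).
    by apply: ereal_inf_lbound; exists (inr y) => //; exists y.
  by rewrite lee_fin; exact: Gr.
apply: ge_ereal_sup => _ [_ [y _ <-] <-]; have [x xy] := C_r y.
apply: (@le_trans _ _ (mdist (inr y : glued G) (inl x))%:E).
  by apply: ereal_inf_lbound; exists (inl x) => //; exists x.
by rewrite lee_fin; exact: Gr.
Qed.

End Correspondence.
End Gluing.

(** * The upper bound *)

Section SineBounds.
Context {R : realType}.
Implicit Types t u v w : R.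

Lemma sin_le_id t : 0 <= t -> sin t <= t.
Proof.
move=> t0; have [c _] := @MVT_segment R sin cos 0 t t0 (fun x _ => is_derive_sin x)
  (continuous_subspaceT (@continuous_sin R)).
by rewrite sin0 !subr0 => ->; rewrite ler_piMl// cos_le1.
Qed.

(** For $n \geq 2$ the bound $\sin w \leq w \leq 2/m$ suffices, as $8(n+1) \leq (2n+1)^2$. For $n =
    1$ there is equality, and $\sin(\pi/6) = 1/2$ comes from the triple angle formula. *)
Lemma sin_pi_div_le n : (0 < n)%N ->
  (2 * n.+1)%:R * sin (pi / (2 * (2 * n).+1%:R)) ^+ 2 <= 1 :> R.
Proof.
move=> n0; set m := (2 * n).+1; set w := pi / _.
have m0 : 0 < m%:R :> R by rewrite ltr0n.
have w0 : 0 < w by rewrite divr_gt0 ?pi_gt0// mulr_gt0.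
have wpi : w <= pi / 2.
  by rewrite /w invfM mulrA ler_piMr ?divr_ge0 ?pi_ge0// invf_le1// ler1n.
have mw : m%:R * w = pi / 2 by rewrite /w; field; rewrite gt_eqF.
have sw0 : 0 < sin w by apply: sin_gt0_pi; rewrite w0 (le_lt_trans wpi)//; have := @pi_gt0 R; lra.
move: n0; rewrite leq_eqVlt => /predU1P[n1|n1].
  have : sin w * dirichlet 1 w = 1.
    rewrite sin_dirichlet -[RHS]sin_pihalf -mw; congr (sin (_%:R * _)).
    by rewrite /m -n1.
  rewrite /dirichlet big_ord_recl big_ord0 addr0 mulr1 [2 * w]mulr_natl cos_mulr2n.
  rewrite cos2sin2 -n1; set s := sin w in sw0 *.
  have -> : s * (1 + 2 * ((1 - s ^+ 2) *+ 2 - 1)) = 3 * s - 4 * s ^+ 3 by ring.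
  move=> s3; have : (s + 1) * (2 * s - 1) ^+ 2 = 0.
    have -> : (s + 1) * (2 * s - 1) ^+ 2 = 1 - (3 * s - 4 * s ^+ 3) by ring.
    by rewrite s3 subrr.
  move=> /eqP; rewrite mulf_eq0 sqrf_eq0 gt_eqF/= ?addr_gt0// subr_eq0 => /eqP s2.
  have -> : (2 * 2)%:R * s ^+ 2 = (2 * s) ^+ 2 by rewrite exprMn natrM expr2.
  by rewrite s2 expr1n.
have sw : sin w <= 2 / m%:R.
  apply: le_trans (sin_le_id (ltW w0)) _; rewrite /w invfM mulrA.
  by rewrite ler_pM2r ?invr_gt0// ltW// pihalf_lt2.
apply: (@le_trans _ _ ((2 * n.+1)%:R * (2 / m%:R) ^+ 2)).
  by rewrite ler_wpM2l// ler_pXn2r// ?nnegrE ?divr_ge0// ltW.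
rewrite expr_div_n mulrA ler_pdivrMr ?exprn_gt0// mul1r -!natrX -natrM ler_nat.
by rewrite /m; nia.
Qed.

(** The kernel $\sin(mv)/\sin v$ decreases up to $w = \pi/2m$, which reduces the claim to
    [sin_pi_div_le]. *)
Lemma sin_mul_ge n v : (0 < n)%N -> 0 <= v <= pi / (2 * (2 * n).+1%:R) ->
  (2 * n.+1)%:R * sin v ^+ 2 <= sin ((2 * n).+1%:R * v) ^+ 2.
Proof.
move=> n0 /andP[v0 vw]; have := sin_pi_div_le n0.
set m := (2 * n).+1 in vw *; set w := pi / _ in vw *.
have m0 : 0 < m%:R :> R by rewrite ltr0n.
have w0 : 0 < w by rewrite divr_gt0 ?pi_gt0// mulr_gt0.
have dw : sin w * dirichlet n w = 1.
  rewrite sin_dirichlet -[RHS]sin_pihalf; congr sin; rewrite -/m /w; field.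
  by rewrite gt_eqF.
have wpi : w < pi.
  rewrite /w ltr_pdivrMr ?mulr_gt0// ltr_pMr ?pi_gt0//.
  by rewrite -natrM ltr1n /m mul2n -addnn addnS.
have sw0 : 0 < sin w by apply: sin_gt0_pi; rewrite w0.
have dw0 : 0 < dirichlet n w.
  by rewrite -(pmulr_rgt0 _ sw0) dw.
have dvw : dirichlet n w <= dirichlet n v.
  rewrite lerD2l ler_wpM2l//; apply: ler_sum => l _.
  have lw : 2 * l.+1%:R * w <= pi.
    rewrite /w mulrA ler_pdivrMr ?mulr_gt0// mulrC ler_pM2l ?pi_gt0//.
    rewrite ler_pM2l// ler_nat /m ltnS (leq_trans (ltnW (ltn_ord l)))//.
    by rewrite leq_pmull.
  have l0 : 0 < 2 * l.+1%:R :> R by rewrite mulr_gt0// ltr0n.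
  have lvw : 2 * l.+1%:R * v <= 2 * l.+1%:R * w by rewrite ler_pM2l.
  have iv : 2 * l.+1%:R * v \in `[0, pi].
    by rewrite in_itv/= mulr_ge0 ?(ltW l0)//= (le_trans lvw).
  have iw : 2 * l.+1%:R * w \in `[0, pi].
    by rewrite in_itv/= lw andbT mulr_ge0 ?ltW.
  by rewrite leNgt ltr_cos// -leNgt.
move=> sw1; rewrite -sin_dirichlet exprMn mulrC ler_wpM2l ?sqr_ge0//.
apply: (@le_trans _ _ (dirichlet n w ^+ 2)); last first.
  by rewrite ler_pXn2r// ?nnegrE ltW// (lt_le_trans dw0).
rewrite -[leRHS]mul1r (le_trans _ (ler_wpM2r (sqr_ge0 _) sw1))//.
by rewrite -mulrA -exprMn dw expr1n mulr1.
Qed.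

Lemma cos_sin_mulrn t u (k : nat) : cos t = cos u -> sin t = sin u ->
  cos (k%:R * t) = cos (k%:R * u) /\ sin (k%:R * t) = sin (k%:R * u).
Proof.
move=> ct st; elim: k => [|k [IHc IHs]]; first by rewrite !mul0r.
by rewrite -[k.+1%:R]natr1 !mulrDl !mul1r !cosD !sinD ct st IHc IHs.
Qed.

End SineBounds.

(** * Peaks of trigonometric polynomials *)

Section TrigonometricCurve.
Context {R : realType}.
Variable n : nat.
Hypothesis n0 : (0 < n)%N.
Local Notation K := (2 * n + 1)%N.
Local Notation m := (2 * n).+1.
Local Notation S := (sphere R K).
Local Notation C := (sphere R 1).
Implicit Types (x y : S) (p q : C) (t u : R).

(* The curve (cos t, sin t, cos 3t, sin 3t, ..., cos mt, sin mt), so that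
   [dotv x (curve t)] runs over the trigonometric polynomials in [t] with odd
   frequencies at most [m]. *)
Definition curve t : 'rV[R]_K.+1 :=
  \row_i cos ((2 * i./2).+1%:R * t - (if odd i then pi / 2 else 0)).

Lemma sum_pairs (N : nat) (F : nat -> R) :
  \sum_(i < 2 * N) F i = \sum_(l < N) (F (2 * l)%N + F (2 * l).+1).
Proof.
elim: N => [|N IH]; first by rewrite !big_ord0.
rewrite -(big_mkord xpredT) (_ : (2 * N.+1)%N = (2 * N).+2); last by rewrite mulnS.
by rewrite !big_nat_recr//= big_mkord IH [RHS]big_ord_recr/= addrA.
Qed.

Lemma dim_eq : K.+1 = (2 * n.+1)%N. Proof. by rewrite addn1 mulnS. Qed.

Lemma dotv_curve t u : dotv (curve t) (curve u) =
  \sum_(l < n.+1) cos ((2 * l).+1%:R * (t - u)).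
Proof.
pose F (i : nat) := cos ((2 * i./2).+1%:R * t - (if odd i then pi / 2 else 0)) *
  cos ((2 * i./2).+1%:R * u - (if odd i then pi / 2 else 0)) : R.
transitivity (\sum_(i < K.+1) F i).
  by apply: eq_bigr => i _; rewrite !mxE.
rewrite -(big_mkord xpredT) dim_eq big_mkord sum_pairs.
apply: eq_bigr => l _; rewrite /F /= oddM /= [(2 * l)%N]mul2n doubleK uphalf_double -mul2n.
by rewrite !subr0 !cosBpihalf mulrBr cosB.
Qed.

Lemma curve_norm t : dotv (curve t) (curve t) = n.+1%:R.
Proof.
rewrite dotv_curve subrr; under eq_bigr do rewrite mulr0 cos0.
by rewrite sumr_const card_ord.
Qed.

Lemma curveDpi t : curve (t + pi) = - curve t.
Proof.
apply/rowP => i; rewrite !mxE mulrDr addrAC cosDnpi exprS exprM sqrrN expr1n.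
by rewrite expr1n mulr1 mulN1r.
Qed.

Lemma eq_curve t u : cos t = cos u -> sin t = sin u -> curve t = curve u.
Proof.
move=> ct st; apply/rowP => i; rewrite !mxE.
have [c s] := cos_sin_mulrn (2 * i./2).+1 ct st.
by case: ifP => _; rewrite ?subr0// !cosBpihalf.
Qed.

Definition trig x t : R := dotv x (curve t).

Lemma trigDpi x t : trig x (t + pi) = - trig x t.
Proof. by rewrite /trig curveDpi dotvNr. Qed.

Lemma trig_antipode x t : trig (antipode x) t = - trig x t.
Proof. by rewrite /trig dotvNl. Qed.

(** Any base point and either direction are allowed, so that Riesz's bound can start from both
    extrema. *)
Lemma trig_lin_odd x (b : bool) t :
  odd_trig n (fun u => trig x (t + (-1) ^+ b * u)).
Proof.
pose ph (i : 'I_K.+1) : R := (2 * i./2).+1%:R * t - (if odd i then pi / 2 else 0).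
rewrite (_ : (fun u => _) = fun u => \sum_(i < K.+1) (x : 'rV_K.+1) 0 i *
    cos ((2 * i./2).+1%:R * u + (-1) ^+ b * ph i)).
  apply: odd_trig_sum => i; apply: odd_trig_cos.
  have := ltn_ord i; rewrite {2}dim_eq => iK.
  by rewrite -ltnS -(ltn_pmul2l (isT : (0 < 2)%N)) (leq_ltn_trans _ iK)// mul2n
    -[leqRHS]odd_double_half leq_addl.
apply/funext => u; apply: eq_bigr => i _; rewrite mxE; congr (_ * _).
case: b; rewrite ?expr0 ?expr1 ?mulN1r ?mul1r /ph.
  by rewrite -[LHS]cosN; congr cos; ring.
by congr cos; ring.
Qed.

Lemma continuous_trig x : continuous (trig x).
Proof.
have [h [ch _] hE] := trig_lin_odd x false 0.
have -> : trig x = fun t => trig x 0 * cos (m%:R * t + 0) + sin t * h t.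
  apply/funext => t; have := hE t; rewrite expr0 !mul1r !add0r => ->.
  by rewrite addr0.
move=> t; apply: cvgD.
  by apply: cvgM; [exact: cvg_cst|exact: continuous_cos_lin].
by apply: cvgM; [exact: continuous_sin|exact: ch].
Qed.

Lemma circle_angle p : exists2 t, t \in `[0, 2 * pi] & at_angle p t.
Proof.
have [[t b] /= [/andP[t0 tpi]]] := circle_half_angle p; have := @pi_gt0 R => pi0.
case: b => pt; first by exists t => //; rewrite in_itv/= t0; lra.
exists (t + pi); first by rewrite in_itv/= addr_ge0 ?pi_ge0//; lra.
by case: pt; rewrite /at_angle (cosDpi t) (sinDpi t) !mxE => <- <-; rewrite !opprK.
Qed.

Lemma circle_point_subproof t : let v : 'rV[R]_2 := \row_i (if i == 0 then cos t else sin t)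
  in dotv v v = 1.
Proof.
by rewrite /dotv !big_ord_recl big_ord0 !mxE /= addr0 -!expr2 cos2Dsin2.
Qed.

Definition circle_point t : C := Sphere (sphere_dotvP (circle_point_subproof t)).

Lemma circle_pointP t : at_angle (circle_point t) t.
Proof. by split; rewrite mxE. Qed.

Lemma trig_max x : exists t, forall u, trig x u <= trig x t.
Proof.
have pi20 : 0 <= 2 * pi :> R by rewrite mulr_ge0 ?pi_ge0.
have [t _ tmax] := EVT_max pi20 (continuous_subspaceT (@continuous_trig x)).
exists t => u; have [v v01 [cv sv]] := circle_angle (circle_point u).
have [cu su] := circle_pointP u.
by rewrite /trig (@eq_curve u v) ?tmax// -?cu -?su.
Qed.

(** The curve sampled at $2(n+1)$ equidistant points of $[0,\pi)$. Its rows being orthogonal,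
    Parseval's identity becomes a finite sum. *)
Definition nodes : 'M[R]_K.+1 := \matrix_(k, i) curve (k%:R * pi / (2 * n.+1)%:R) 0 i.

Lemma nodes_orthogonal : nodes *m nodes^T = n.+1%:R%:M.
Proof.
apply/matrixP => j k; rewrite !mxE.
transitivity (dotv (curve (j%:R * pi / (2 * n.+1)%:R)) (curve (k%:R * pi / (2 * n.+1)%:R))).
  by apply: eq_bigr => i _; rewrite !mxE.
have [->|jk] := eqVneq j k; first by rewrite curve_norm.
rewrite dotv_curve mulr0n.
wlog : j k jk / (k < j)%N.
  move=> H; case: (ltngtP j k) => [kj|/H|/val_inj e]; last by rewrite e eqxx in jk.
    rewrite -[RHS](H k j) 1?eq_sym//; apply: eq_bigr => l _.
    by rewrite -cosN; congr cos; ring.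
  exact.
move=> kj; set D := _ - _.
have NE : (2 * n.+1)%:R != 0 :> R by rewrite pnatr_eq0.
have DE : D = (j - k)%:R * pi / (2 * n.+1)%:R.
  by rewrite /D natrB ?(ltnW kj)//; ring.
have sD : sin D != 0.
  rewrite gt_eqF// sin_gt0_pi// DE divr_gt0 ?mulr_gt0 ?pi_gt0 ?ltr0n ?subn_gt0//=.
  rewrite ltr_pdivrMr ?ltr0n// mulrC ltr_pM2l ?pi_gt0// ltr_nat -dim_eq.
  by rewrite (leq_ltn_trans (leq_subr _ _)).
(* The sum is $\sin(2(n+1)D)/(2\sin D)$, and $2(n+1)D$ is a multiple of $\pi$. *)
apply: (mulfI (x := 2 * sin D)); first by rewrite mulf_neq0.
rewrite mulr0 -[RHS](subrr (sin 0)) -{3}(subrr D).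
transitivity (2 * sin D * \sum_(i < n.+1) cos (i%:R * (2 * D) + D)).
  congr (_ * _); apply: eq_bigr => l _; congr cos.
  by rewrite -[(2 * l).+1%:R]natr1 natrM; ring.
rewrite sum_cos_arith subrr; congr (_ - _).
rewrite subrK (_ : _ * _ = 0 + (j - k)%:R * pi); last by rewrite DE natrM; field.
by rewrite sinDnpi sin0 mulr0.
Qed.

Lemma sum_trig_nodes x :
  \sum_(k < K.+1) trig x (k%:R * pi / (2 * n.+1)%:R) ^+ 2 = n.+1%:R.
Proof.
have n1 : n.+1%:R != 0 :> R by rewrite pnatr_eq0.
have Q : nodes^T *m nodes = n.+1%:R%:M.
  have /mulmx1C : nodes *m (n.+1%:R^-1 *: nodes^T) = 1%:M.
    by rewrite -scalemxAr nodes_orthogonal scale_scalar_mx mulVf.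
  rewrite -scalemxAl => /(congr1 (fun A => n.+1%:R *: A)).
  by rewrite scalerA divff// scale1r scalemx1.
pose P := nodes *m (x : 'rV_K.+1)^T.
transitivity ((P^T *m P) 0 0).
  rewrite mxE; apply: eq_bigr => k _; rewrite !mxE expr2.
  suff -> : trig x (k%:R * pi / (2 * n.+1)%:R) =
    \sum_j nodes k j * (x : 'rV_K.+1)^T j 0 by [].
  by apply: eq_bigr => i _; rewrite !mxE mulrC.
rewrite /P trmx_mul trmxK mulmxA -(mulmxA (x : 'rV_K.+1)) Q.
rewrite mul_mx_scalar -scalemxAl mxE.
suff -> : ((x : 'rV_K.+1) *m (x : 'rV_K.+1)^T) 0 0 = 1 by rewrite mulr1.
by rewrite -(dotv_sphere x) mxE; apply: eq_bigr => i _; rewrite mxE.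
Qed.

(** The squares at the nodes have mean 1/2, and oddness turns the maximum into a bound on the
    absolute value. *)
Lemma trig_max_ge x t : (forall u, trig x u <= trig x t) ->
  [/\ forall u, `|trig x u| <= trig x t, 0 <= trig x t & 1 <= 2 * trig x t ^+ 2].
Proof.
move=> tmax; have nmax u : `|trig x u| <= trig x t.
  by rewrite ler_norml tmax lerNl -trigDpi tmax.
have t0 : 0 <= trig x t by apply: le_trans (nmax t).
split => //; rewrite -(@ler_pM2l _ n.+1%:R) ?ltr0n// mulr1 -[leLHS](sum_trig_nodes x).
apply: (@le_trans _ _ (\sum_(k < K.+1) trig x t ^+ 2)).
  apply: ler_sum => k _; rewrite -real_normK ?num_real//.
  by rewrite ler_pXn2r ?nnegrE ?normr_ge0.
by rewrite sumr_const card_ord dim_eq -[_ *+ (2 * _)]mulr_natl natrM [2 * n.+1%:R]mulrC -mulrA.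
Qed.

Lemma trig_separation x y (b : bool) t (s : R) : 0 <= s <= pi / m%:R ->
    (forall u, trig x u <= trig x t) ->
    (forall u, trig y (t + (-1) ^+ b * s) <= trig y u) ->
  pi / m%:R - s <= mdist x y.
Proof.
move=> /andP[s0 sm] xmax ymin; have m0 : 0 < m%:R :> R by rewrite ltr0n.
set u := t + _ in ymin.
have y'max v : trig (antipode y) v <= trig (antipode y) u.
  by rewrite !trig_antipode lerN2.
have [xn xp x2] := trig_max_ge xmax; have [yn yp y2] := trig_max_ge y'max.
set A := trig x t in xn xp x2 xmax; set B := trig _ u in yn yp y2 y'max.
set c := cos (m%:R * (s / 2)).
have s2 : 0 <= s / 2 <= pi / m%:R.
  by rewrite divr_ge0//= (le_trans _ sm)// ler_pdivrMr// ler_peMr//; lra.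
(* The midpoint of the two extrema, reached from either at time [s / 2]. *)
pose v := t + (-1) ^+ b * (s / 2).
have xv : A * c <= trig x v.
  have := riesz_cos_bound (trig_lin_odd x b t) _ s2; rewrite mulr0 addr0; exact.
have yv : B * c <= trig (antipode y) v.
  have := riesz_cos_bound (trig_lin_odd (antipode y) (~~ b) u) _ s2.
  rewrite mulr0 addr0 -/B (_ : u + _ = v); first by apply.
  by rewrite signrN /u /v; field.
have c0 : 0 <= c.
  apply: cos_ge0_pihalf; have : m%:R * (s / 2) <= pi / 2.
    by rewrite mulrA ler_pM2r// mulrC -ler_pdivlMr.
  have : 0 <= m%:R * (s / 2) by rewrite mulr_ge0 ?divr_ge0// ltW.
  by have := @pi_gt0 R; move=> *; lra.
pose d : 'rV[R]_K.+1 := (x : 'rV_K.+1) - (y : 'rV_K.+1).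
have dv : (A + B) * c <= dotv d (curve v).
  by rewrite mulrDl /d dotvDl dotvNl -trig_antipode lerD.
have dd : dotv d d = 2 * (1 - dotv x y).
  rewrite /d dotvDl !dotvDr !dotvNl !dotvNr !dotv_sphere (dotvC (y : 'rV_K.+1)); ring.
have CS := dotv_CauchySchwarz d (curve v); rewrite curve_norm dd in CS.
have AB : 2 <= (A + B) ^+ 2.
  have AB2 : 1 <= (2 * (A * B)) ^+ 2.
    have -> : (2 * (A * B)) ^+ 2 = (2 * A ^+ 2) * (2 * B ^+ 2) by ring.
    by rewrite -[leLHS]mulr1 ler_pM.
  have : 1 <= 2 * (A * B) by rewrite -(@expr_ge1 _ 2)// !mulr_ge0.
  by rewrite sqrrD; lra.
have cc : 2 * c ^+ 2 <= 2 * (1 - dotv x y) * n.+1%:R.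
  apply: le_trans CS; apply: (@le_trans _ _ (((A + B) * c) ^+ 2)).
    by rewrite exprMn ler_wpM2r ?sqr_ge0.
  by rewrite ler_pXn2r// nnegrE ?mulr_ge0 ?addr_ge0// (le_trans _ dv)// mulr_ge0// addr_ge0.
(* Half of the claimed distance. As $c = \sin(mw)$, [sin_mul_ge] and [cc] give $2\sin^2 w \leq 1 -
   \langle x,y\rangle$, that is $\langle x,y\rangle \leq \cos 2w$. *)
pose w := (pi / m%:R - s) / 2.
have w01 : 0 <= w <= pi / (2 * m%:R).
  rewrite divr_ge0 ?subr_ge0//= /w invfM mulrA mulrAC ler_pM2r ?invr_gt0//.
  by rewrite mulrC gerBl.
have := sin_mul_ge n0 w01.
have -> : sin (m%:R * w) = c.
  have -> : m%:R * w = pi / 2 - m%:R * (s / 2).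
    by rewrite /w; field; rewrite gt_eqF.
  by rewrite sinB sin_pihalf cos_pihalf /c; ring.
move=> sc; rewrite leNgt; apply/negP => xys.
have xys' : geodesic_dist x y < 2 * w by rewrite /w mulrC divfK.
have : cos (2 * w) < dotv x y.
  rewrite -cos_geodesic_dist ltr_cos// in_itv/= ?geodesic_dist_bound//.
  case/andP: w01 => w0 w1; rewrite mulr_ge0//= /w mulrC divfK//.
  rewrite lerBlDr (le_trans (_ : _ <= pi))// ?lerDl//.
  by rewrite ler_pdivrMr// ler_peMr ?pi_ge0// ler1n.
rewrite [2 * w]mulr_natl cos_mulr2n cos2sin2.
have n1 : 0 < n.+1%:R :> R by rewrite ltr0n.
have : sin w ^+ 2 * n.+1%:R <= (1 - dotv x y) / 2 * n.+1%:R.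
  by move: sc cc; rewrite natrM; set z := n.+1%:R; lra.
by rewrite ler_pM2r//; lra.
Qed.

Definition peak_rel p x := exists2 t, at_angle p t & forall u, trig x u <= trig x t.

(** For the normalized [curve t], the polynomial is a positive multiple of a sum of cosines of
    multiples of $t-u$, all equal to 1 at $u = t$. *)
Lemma peak_rel_l p : exists x, peak_rel p x.
Proof.
have [t _ pt] := circle_angle p.
have tpos : 0 < dotv (curve t) (curve t) by rewrite curve_norm ltr0n.
exists (radial (curve t)), t => // u.
rewrite /trig radialE// !dotvZl ler_wpM2l ?invr_ge0 ?sqrtr_ge0//.
rewrite curve_norm dotv_curve (le_trans (_ : _ <= \sum_(l < n.+1) 1))//.
  by apply: ler_sum => l _; exact: cos_le1.
by rewrite sumr_const card_ord.
Qed.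

Lemma peak_rel_r x : exists p, peak_rel p x.
Proof.
have [t tmax] := trig_max x.
by exists (circle_point t), t => //; exact: circle_pointP.
Qed.

Lemma peak_rel_antipode p x : peak_rel p x -> peak_rel (antipode p) (antipode x).
Proof.
move=> [t [c s] tmax]; exists (t + pi).
  by rewrite /at_angle (cosDpi t) (sinDpi t) !mxE c s.
by move=> u; rewrite trigDpi !trig_antipode opprK -trigDpi.
Qed.

Lemma peak_rel_le p q x y : peak_rel p x -> peak_rel q y ->
  mdist p q <= mdist x y + (pi - pi / m%:R).
Proof.
move=> [t pt xmax] [w qw ymax]; have m0 : 0 < m%:R :> R by rewrite ltr0n.
rewrite -![mdist _ _]/(geodesic_dist _ _).
have /andP[xy0 _] := geodesic_dist_bound x y.
have [pq|pq] := leP (geodesic_dist p q) (pi - pi / m%:R).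
  by rewrite (le_trans pq)// lerDr.
(* The polynomial of [y] is minimal at [w + pi], which is at distance [s] from [t] on the circle. *)
pose s := pi - geodesic_dist p q.
have s01 : 0 <= s <= pi / m%:R.
  rewrite subr_ge0 /s; case/andP: (geodesic_dist_bound p q) => _ -> /=.
  by rewrite lerBlDr -lerBlDl ltW.
have cs : cos s = - cos (t - w).
  by rewrite /s cosB cospi sinpi mul0r addr0 mulN1r
    cos_geodesic_dist (dotv_at_angle pt qw).
have cb : cos (w + pi - t) = cos s.
  by rewrite cs addrAC (cosDpi (w - t)) -cosN opprB.
(* Modulo $2\pi$, $w+\pi$ is $t+s$ or $t-s$; [b] records which. *)
have [b sb] : exists b : bool, sin (w + pi - t) = (-1) ^+ b * sin s.
  have : (sin (w + pi - t) - sin s) * (sin (w + pi - t) + sin s) = 0.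
    by rewrite -subr_sqr !sin2cos2 cb subrr.
  move/eqP; rewrite mulf_eq0 => /orP[|].
    by rewrite subr_eq0 => /eqP ->; exists false; rewrite mul1r.
  by rewrite addr_eq0 => /eqP ->; exists true; rewrite expr1 mulN1r.
have eq_c : curve (t + (-1) ^+ b * s) = curve (w + pi).
  have sgs : cos ((-1) ^+ b * s) = cos s /\ sin ((-1) ^+ b * s) = (-1) ^+ b * sin s.
    by case: (b); rewrite ?expr1 ?mulN1r ?cosN ?sinN ?expr0 ?mul1r.
  rewrite -[in RHS](subrK t (w + pi)) [_ + t]addrC.
  move: sgs cb sb; move: (w + pi - t) (_ * s) => z z' [cz sz] cb sb.
  by apply: eq_curve; rewrite ?cosD ?sinD cz sz cb sb.
suff : pi / m%:R - s <= geodesic_dist x y 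
  by rewrite /s; move: (pi / m%:R) (geodesic_dist p q) (geodesic_dist x y) => *; lra.
apply: (@trig_separation x y b t s s01 xmax) => u; rewrite {1}/trig eq_c -/(trig _ _) trigDpi lerNl -trigDpi.
exact: ymax.
Qed.

(** The second inequality is [peak_rel_le] for the antipodes of [q] and [y], where both distances
    $d$ become $\pi - d$. *)
Lemma peak_rel_dis p q x y : peak_rel p x -> peak_rel q y ->
  `|mdist p q - mdist x y| <= 2 * (pi * n%:R / (2 * n%:R + 1)).
Proof.
move=> px qy; have := peak_rel_le px qy.
have := peak_rel_le px (peak_rel_antipode qy).
rewrite ![mdist _ (antipode _)]metric_sym !mdist_antipode.
rewrite [mdist q p]metric_sym [mdist y x]metric_sym ler_norml.
have -> : 2 * (pi * n%:R / (2 * n%:R + 1)) = pi - pi / m%:R :> R.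
  rewrite -[m%:R]natr1 natrM; field.
  by rewrite -natrM natr1 pnatr_eq0.
rewrite -![mdist _ _]/(geodesic_dist _ _).
move: (pi / m%:R) (geodesic_dist p q) (geodesic_dist x y) => *.
by apply/andP; split; lra.
Qed.

End TrigonometricCurve.

Theorem theorem1p4 (R : realType) (n : nat) (hn : (1 <= n)%N) :
  gromov_hausdorff_dist (sphere R 1) (sphere R (2 * n + 1)) =
  (pi * n%:R / (2 * n%:R + 1))%:E.
Proof.
apply/eqP; rewrite eq_le; apply/andP; split.
  apply: (@gromov_hausdorff_le _ _ _ (@peak_rel R n)).
  - by rewrite divr_gt0 ?mulr_gt0 ?pi_gt0 ?ltr0n// addr_gt0// mulr_gt0 ?ltr0n.
  - exact: peak_rel_l.
  - exact: peak_rel_r.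
  - by move=> p q x y; exact: peak_rel_dis.
apply: le_ereal_inf_tmp => _ [Z [X [Y [cX cY ->]]]].
exact: hausdorff_dist_ge.
Qed.
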